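(* Let $(r_n)_{n\ge0}$ be an admissible sequence. (a) If $\sum_{j=0}^\infty 4^{-j}r_j^{-1}<\infty$, then for any choice of angles $(\omega_{\mathbf i})_{\mathbf i\in[4]^*}$ in $[0,2\pi]$ the associated Cantor set $K$ satisfies $\mathrm{Fav}(K)>0$. (b) If $\sum_{j=0}^\infty 4^{-j}r_j^{-1}=\infty$, then in either the independent rotations model or the synchronized rotations model, almost surely the associated Cantor set $K$ satisfies $\mathrm{Fav}(K)=0$.
   Context: Favard length: for $\theta\in[0,\pi]$ let $\mathrm{proj}_\theta(x)=x\cdot(\cos\theta,\sin\theta)$ for $x\in\mathbb{R}^2$; for a Borel set $E\subset\mathbb{R}^2$, $\mathrm{Fav}(E)=\int_0^\pi|\mathrm{proj}_\theta(E)|\,d\theta$, where $|\cdot|$ is one-dimensional Lebesgue measure. Admissible sequence: a sequence $r_0\ge r_1\ge r_2\ge\cdots$ of nonnegative reals with $r_{n+1}\le \frac13 r_n$ for all $n\ge0$. The degenerate case in which $r_n=0$ for all $n$ from some index on is allowed, with the convention $1/0=\infty$. Cantor set: let $[4]=\{0,1,2,3\}$, let $[4]^*$ be the set of finite words over $[4]$ (including the empty word $\varnothing$), and let $|\mathbf{i}|$ be the length of $\mathbf{i}$. Write $B(x,r)$ for the closed disc and $u(t)=(\cos t,\sin t)$. Given an admissible sequence $(r_n)$ and angles $(\omega_{\mathbf i})_{\mathbf i\in[4]^*}$ in $[0,2\pi]$, define $D_\varnothing=B(0,r_0)$, and if $|\mathbf i|=k$ and $D_{\mathbf i}=B(c_{\mathbf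 i},r_k)$, then for $j\in[4]$ put $D_{\mathbf i j}=B\big(c_{\mathbf i}+(r_k-r_{k+1})\,u(\omega_{\mathbf i}+\tfrac{2\pi j}{4}),\,r_{k+1}\big)$. Set $K_n=\bigcup_{|\mathbf i|=n}D_{\mathbf i}$ and $K=\bigcap_{n\ge0}K_n$. Random models (radii fixed, angles random). Synchronized rotations model: $\omega_0,\omega_1,\dots$ are i.i.d. uniform in $[0,2\pi]$ and $\omega_{\mathbf i}=\omega_{|\mathbf i|}$. Independent rotations model: all $\omega_{\mathbf i}$, $\mathbf i\in[4]^*$, are independent and uniform in $[0,2\pi]$. *)

(* Defs.v *)
From HB Require Import structures.
From mathcomp Require Import all_boot all_order all_algebra.
From mathcomp Require Import all_classical all_reals all_analysis.

Set Implicit Arguments.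
Unset Strict Implicit.
Unset Printing Implicit Defensive.

Import Order.TTheory GRing.Theory Num.Theory.
Import numFieldNormedType.Exports.

Local Open Scope classical_set_scope.
Local Open Scope ring_scope.

Section favard_length.
Context {R : realType}.

Definition linear_proj (theta : R) (x : R * R) : R :=
  x.1 * cos theta + x.2 * sin theta.

(* [lebesgue_measure] is total on sets of reals (an outer measure); the
   projections of a compact set are compact, hence Borel. *)
Definition Fav (E : set (R * R)) : \bar R :=
  (\int[lebesgue_measure]_(theta in `[0%R, pi])
     lebesgue_measure (linear_proj theta @` E))%E.

End favard_length.

Section cantor_set.
Context {R : realType}.

Definition admissible (r : nat -> R) : Prop :=
  (forall n, 0 <= r n) /\
  (forall n, r n.+1 <= r n) /\
  (forall n, r n.+1 <= 3^-1 * r n).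

(* Euclidean closed disc; the norm that the library puts on R * R is the
   supremum norm, so the library's balls cannot be used here. *)
Definition disc (c : R * R) (r : R) : set (R * R) :=
  [set x | Num.sqrt ((x.1 - c.1) ^+ 2 + (x.2 - c.2) ^+ 2) <= r].

Definition unit_vec (t : R) : R * R := (cos t, sin t).

Definition word := seq 'I_4.

(* Centre of the disc of the child [rcons i j], given the centre [c] of the
   disc of [i]. *)
Definition child_center (r : nat -> R) (omega : word -> R)
    (i : word) (c : R * R) (j : 'I_4) : R * R :=
  let u := unit_vec (omega i + 2 * pi * j%:R / 4) in
  let rho := r (size i) - r (size i).+1 in
  (c.1 + rho * u.1, c.2 + rho * u.2).

(* Words are read from the first letter on: [i] is the prefix already read,
   with centre [c], and [s] is the rest of the word. *)
Fixpoint center_from (r : nat -> R) (omega : word -> R)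
    (i : word) (c : R * R) (s : word) : R * R :=
  if s is j :: s' then
    center_from r omega (rcons i j) (child_center r omega i c j) s'
  else c.

Definition center (r : nat -> R) (omega : word -> R) (i : word) : R * R :=
  center_from r omega [::] (0, 0) i.

Lemma center_nil r omega : center r omega [::] = (0, 0).
Proof. by []. Qed.

Lemma center_rcons r omega (i : word) (j : 'I_4) :
  center r omega (rcons i j) =
  child_center r omega i (center r omega i) j.
Proof.
rewrite /center -[in child_center _ _ i](cat0s i).
move: [::] (0, 0) => p c; elim: i p c => [|k s IHs] p c /=.
  by rewrite cats0.
by rewrite IHs cat_rcons.
Qed.

Definition cantor_disc (r : nat -> R) (omega : word -> R) (i : word) :
  set (R * R) := disc (center r omega i) (r (size i)).

Definition cantor_stage (r : nat -> R) (omega : word -> R) (n : nat) :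
  set (R * R) :=
  \bigcup_(i in [set i : word | size i = n]) cantor_disc r omega i.

Definition cantor (r : nat -> R) (omega : word -> R) : set (R * R) :=
  \bigcap_n cantor_stage r omega n.

End cantor_set.

Section random_models.
Context {R : realType} {d : measure_display} {T : measurableType d}
  (P : probability T R).

Definition mutually_independent (I : eqType) (X : I -> {RV P >-> R}) : Prop :=
  forall (s : seq I) (A : I -> set R), uniq s ->
    (forall i, measurable (A i)) ->
    P (\bigcap_(i in [set` s]) (X i @^-1` A i)) =
    (\prod_(i <- s) P (X i @^-1` A i))%E.

Lemma two_pi_gt0 : 0 < 2 * pi :> R.
Proof. by rewrite mulr_gt0 // pi_gt0. Qed.

Definition uniform_angle (X : {RV P >-> R}) : Prop :=
  forall A : set R, measurable A ->
    distribution P X A = uniform_prob two_pi_gt0 A.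

Definition iid_uniform_angles (I : eqType) (X : I -> {RV P >-> R}) : Prop :=
  mutually_independent X /\ forall i, uniform_angle (X i).

End random_models.

(* Main.v *)
Require Import Defs.
From HB Require Import structures.
From mathcomp Require Import all_boot all_order all_algebra.
From mathcomp Require Import all_classical all_reals all_analysis.
From mathcomp Require Import measurable_realfun ring lra.

Set Implicit Arguments.
Unset Strict Implicit.
Unset Printing Implicit Defensive.

Import Order.TTheory GRing.Theory Num.Theory.
Import numFieldNormedType.Exports.

Local Open Scope classical_set_scope.
Local Open Scope ring_scope.

(** The theorem follows from two matching estimates for the Favard length of the
    stages of the construction, in terms of the partial sums
    s_n = \sum_(l < n) 4 ^- l / r l.  In every direction the projection of
    [cantor] is the intersection of the decreasing projections of the stages
    (compactness, [image_linear_proj_cantor]), so the Favard length of [cantor] is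
    the limit of those of the stages ([cvg_Fav_stage]).

    If the series converges, every choice of angles gives
    Fav (stage n) >= pi ^ 2 / (64 S), where S is the sum.  This is a second moment
    argument.  In a given direction, count the discs of stage [n] whose projection
    contains a point; the count has integral 4 ^ n * 2 * r n, and the integral of
    its square is a sum over pairs of discs with overlapping projections.
    Integrated over the directions, a pair of discs whose centres are at distance
    rho contributes at most of the order of r n ^ 2 / rho
    ([measure_almost_orthogonal]), and two words that branch after [l] letters
    have centres at distance at least [r l / 4]
    ([center_from_separated]); summing over pairs yields s_n.

    If the series diverges, fix a direction.  The projection of the part of a
    stage below a word is the union of four translates of the projections of the
    parts below its children, and the translations depend only on the angle of
    that word, which is independent of the angles below.  As this angle
    varies, the relative position of the first two translates takes all the values
    for which they can meet, with a density of order at least 1 / r k, so their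
    overlap has mean at least of the order of the product of their lengths divided
    by r k ([overlap_lower_bound], [mean_shadow_step]).  The mean of the product of
    the two lengths is at least the product of the means: in the first model the
    lengths are independent, in the second they are equal.  For the means e_k at
    level k this gives e_k + c * e_(k+1) ^ 2 / r k <= 4 * e_(k+1), whose solution
    satisfies e_0 <= C / s_n ([length_recursion]).  Integrating over the
    directions, the Favard length of [cantor] has mean zero.

    The projections below a word are encoded by [proj_stage], which depends
    measurably on the angles and on the direction; this makes Fubini's theorem
    applicable throughout. *)

(** * Lebesgue measure of Lipschitz images and translates *)

Lemma lebesgue_measure_diam {R : realType} (A : set R) (l : R) :
  0 <= l -> (forall x y, A x -> A y -> x - y <= l) ->
  (lebesgue_measure A <= l%:E)%E.
Proof.
move=> l0 Al; have [->|/set0P [a Aa]] := eqVneq A set0.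
  by rewrite measure0 lee_fin.
have hsA : has_sup A.
  by split; [exists a | exists (a + l) => x Ax; rewrite addrC -lerBlDr Al].
have /le_trans : (lebesgue_measure A <=
    lebesgue_measure (`[(sup A - l)%R, sup A] : set R))%E.
  apply: le_outer_measure => x Ax /=.
  rewrite in_itv /= (ub_le_sup _ Ax) ?andbT; last by case: hsA.
  rewrite lerBlDl ge_sup //; first by exists a.
  by move=> y Ay; rewrite addrC -lerBlDl Al.
by apply; rewrite lebesgue_measure_itv /= lte_fin; case: ifPn => _; rewrite ?lee_fin //;
  lra.
Qed.

(** Cover the set by intervals of total length close to its measure; each
    piece is mapped to a set of diameter at most [M] times its length. *)
Lemma lebesgue_measure_lipschitz {R : realType} (f : R -> R) (M : R)
    (A : set R) :
  0 < M -> (forall x y, A x -> A y -> `|f x - f y| <= M * `|x - y|) ->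
  (lebesgue_measure (f @` A) <= M%:E * lebesgue_measure A)%E.
Proof.
move=> M0 fM.
rewrite -lee_pdivrMl //.
rewrite {2}/lebesgue_measure /lebesgue_stieltjes_measure /measure_extension.
rewrite /mu_ext; apply: le_ereal_inf_tmp => _ [/= B [mB AB] <-].
rewrite lee_pdivrMl //.
have sub : f @` A `<=` \bigcup_k (f @` (A `&` B k)).
  move=> _ [x Ax <-]; have [k _ Bkx] := AB x Ax.
  by exists k => //; exists x.
have /le_trans -> // : (lebesgue_measure (f @` A) <=
    lebesgue_measure (\bigcup_k (f @` (A `&` B k)) : set R))%E.
  exact: le_outer_measure.
have /le_trans -> // := outer_measure_sigma_subadditive
  (@lebesgue_measure R) (fun k => f @` (A `&` B k)).
rewrite -nneseriesZl; last by move=> k _; apply: wlength_ge0.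
apply: lee_nneseries => k // _.
have [[a b] /= _ <-] := mB k.
have [ab|ba] := leP a b; last first.
  rewrite set_itv_ge; last by rewrite bnd_simp -leNgt ltW.
  by rewrite setI0 image_set0 measure0 outer_measure0 mule0.
rewrite wlength_itv_bnd // -EFinM.
apply: lebesgue_measure_diam; first by rewrite mulr_ge0 ?subr_ge0 // ltW.
move=> _ _ [x [Ax /= /[!in_itv]/= xab] <-] [y [Ay /= /[!in_itv]/= yab] <-].
rewrite (le_trans (ler_norm _)) // (le_trans (fM _ _ Ax Ay)) //.
by rewrite ler_pM2l // ler_norml; apply/andP; split; lra.
Qed.

(** A translation and its inverse are both 1-Lipschitz; so the identity holds
    for every set, measurable or not. *)
Lemma lebesgue_measure_shift {R : realType} (c : R) (A : set R) :
  lebesgue_measure [set x | A (x - c)] = lebesgue_measure A.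
Proof.
apply/eqP; rewrite eq_le; apply/andP; split.
  have -> : [set x | A (x - c)] = (fun x => x + c) @` A.
    apply/seteqP; split => [x Ax|_ [x Ax <-]]; last by rewrite /= addrK.
    by exists (x - c) => //; rewrite subrK.
  rewrite -[leRHS]mul1e; apply: lebesgue_measure_lipschitz => // x y _ _.
  by rewrite mul1r opprD addrACA subrr addr0.
have imA : A = (fun x => x - c) @` [set x | A (x - c)].
  apply/seteqP; split => [x Ax|_ [x Ax <-]] //.
  by exists (x + c); rewrite /= addrK.
rewrite {1}imA -[leRHS]mul1e; apply: lebesgue_measure_lipschitz => // x y _ _.
by rewrite mul1r opprD addrACA subrr addr0.
Qed.

(** * Projected displacements of the children *)

Lemma xsection_setE {T1 T2 : Type} (Q : T1 * T2 -> Prop) (x : T1) :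
  xsection [set z | Q z] x = [set y | Q (x, y)].
Proof.
by rewrite /xsection; apply/seteqP; split => y /=; rewrite inE.
Qed.

Lemma ysection_setE {T1 T2 : Type} (Q : T1 * T2 -> Prop) (y : T2) :
  ysection [set z | Q z] y = [set x | Q (x, y)].
Proof.
by rewrite /ysection; apply/seteqP; split => x /=; rewrite inE.
Qed.

Lemma measure_sections_swap {d1 d2} {T1 : measurableType d1}
    {T2 : measurableType d2} {R : realType}
    (m1 : {sigma_finite_measure set T1 -> \bar R})
    (m2 : {sigma_finite_measure set T2 -> \bar R}) (A : set (T1 * T2)) :
  measurable A ->
  (\int[m1]_x m2 (xsection A x) = \int[m2]_y m1 (ysection A y))%E.
Proof.
move=> mA; have := indic_fubini_tonelli m1 m2 mA.
by rewrite indic_fubini_tonelli_FE ?indic_fubini_tonelli_GE.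
Qed.

Lemma cos_lipschitz {R : realType} (x y : R) : `|cos x - cos y| <= `|x - y|.
Proof.
wlog xy : x y / y <= x.
  move=> h; have [/h//|/ltW/h] := leP y x.
  by rewrite (distrC (cos y)) (distrC y).
have [c _ ->] := @MVT_segment R cos (fun x => - sin x) y x xy
  (fun z _ => is_derive_cos z) (continuous_subspaceT (@continuous_cos R)).
by rewrite normrM normrN ler_piMl // sin_max.
Qed.

(** The displacement of the [j]-th child relative to its parent, projected in
    direction [theta]: [rho] is the distance between the two centres and [w] the
    angle attached to the parent. *)
Definition child_shift {R : realType} (rho w theta : R) (j : 'I_4) : R :=
  rho * cos (w + 2 * pi * j%:R / 4 - theta).

Definition child1 : 'I_4 := lift ord0 ord0.

Lemma child_shift_diff_lipschitz {R : realType} (rho theta x y : R) (j k : 'I_4) :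
  0 <= rho ->
  `|(child_shift rho x theta j - child_shift rho x theta k) -
    (child_shift rho y theta j - child_shift rho y theta k)| <=
  2 * rho * `|x - y|.
Proof.
move=> rho0; rewrite /child_shift -!mulrBr normrM ger0_norm //.
rewrite (_ : 2 * rho * _ = rho * (`|x - y| + `|x - y|)); last by ring.
rewrite ler_wpM2l //.
have h (i : 'I_4) : `|cos (x + 2 * pi * i%:R / 4 - theta) -
    cos (y + 2 * pi * i%:R / 4 - theta)| <= `|x - y|.
  rewrite (le_trans (cos_lipschitz _ _)) //.
  by rewrite (_ : _ - (y + _ - _) = x - y) //; ring.
have -> : forall a b c d : R, a - b - (c - d) = (a - c) - (b - d).
  by move=> a b c d; ring.
by rewrite (le_trans (ler_normB _ _)) // lerD.
Qed.

(** The relative position of the projections of two neighbouring children takes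
    every value up to [rho] as the angle of the parent varies. *)
Lemma child_shift_diff_onto {R : realType} (rho theta v : R) :
  0 <= theta <= pi -> `|v| <= rho ->
  exists2 phi : R, 0 <= phi <= 2 * pi &
    child_shift rho phi theta ord0 - child_shift rho phi theta child1 = v.
Proof.
move=> /andP[t0 tpi]; rewrite ler_norml => /andP[v1 v2].
have E phi : child_shift rho phi theta ord0 - child_shift rho phi theta child1 =
    rho * (cos (phi - theta) + sin (phi - theta)).
  rewrite /child_shift mulr0 mul0r addr0 /= mulr1.
  have -> : phi + 2 * pi / 4 - theta = (phi - theta) + pi / 2 by field.
  by rewrite cosDpihalf mulrN opprK -mulrDr.
(* The difference is [rho * (cos + sin)] of the relative angle, which runs from
   [rho] to [- rho] over the half-turn starting at [theta]; the latter lies in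
   [0, 2 pi] because [theta] does not exceed [pi]. *)
have [|||c] := @IVT R (fun phi => rho * (cos (phi - theta) + sin (phi - theta)))
  theta (theta + pi) v.
- by rewrite lerDl pi_ge0.
- apply: continuous_subspaceT => x; apply: cvgM; first exact: cvg_cst.
  have h : (fun x : R => x - theta) y @[y --> x] --> x - theta.
    by apply: cvgB; [exact: cvg_id | exact: cvg_cst].
  by apply: cvgD; [apply: (cvg_comp _ _ h); exact: continuous_cos |
    apply: (cvg_comp _ _ h); exact: continuous_sin].
- rewrite subrr cos0 sin0 addr0 mulr1 addrAC subrr add0r cospi sinpi addr0 mulrN1.
  by rewrite ge_min le_max v1 v2 !orbT.
- rewrite in_itv /= => /andP[c1 c2] <-; exists c; last exact: E.
  have := @pi_ge0 R; lra.
Qed.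

(** * Mean overlap of two rotated translates *)

Lemma measurable_preimageT {d d'} {T : measurableType d} {T' : measurableType d'}
    (f : T -> T') (B : set T') :
  measurable_fun setT f -> measurable B -> measurable [set x | B (f x)].
Proof. by move=> mf mB; rewrite -[X in measurable X]setTI; exact: mf. Qed.

Lemma measurable_child_shift {d} {T : measurableType d} {R : realType}
    (rho : R) (w theta : T -> R) (j : 'I_4) :
  measurable_fun setT w -> measurable_fun setT theta ->
  measurable_fun setT (fun t => child_shift rho (w t) (theta t) j).
Proof.
move=> mw mt; apply: measurable_funM => //.
apply: (measurableT_comp (continuous_measurable_fun (@continuous_cos R))).
by apply: measurable_funB => //; apply: measurable_funD.
Qed.

(** By Fubini, the integral of the overlap is the integral over [x] in [B0] of the
    measure of the set of rotations whose relative shift carries [x] into [B1].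
    The relative shift maps this set onto [B1 - x], because all the values needed
    are at most [2 * q <= rho] in absolute value, and it is [2 * rho]-Lipschitz;
    so the set has measure at least that of [B1] divided by [2 * rho]. *)
Lemma overlap_lower_bound {R : realType} (q rho theta : R) (B0 B1 : set R) :
  0 < rho -> 2 * q <= rho -> 0 <= theta <= pi ->
  measurable B0 -> measurable B1 ->
  (forall x, B0 x -> `|x| <= q) -> (forall x, B1 x -> `|x| <= q) ->
  (lebesgue_measure B0 * lebesgue_measure B1 <=
   (2 * rho)%:E * \int[lebesgue_measure]_(phi in `[0%R, (2 * pi)%R])
     lebesgue_measure [set x | B0 (x - child_shift rho phi theta ord0)%R /\
                               B1 (x - child_shift rho phi theta child1)%R])%E.
Proof.
move=> rho0 qrho tpi mB0 mB1 B0q B1q.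
pose tau phi := child_shift rho phi theta ord0 - child_shift rho phi theta child1.
pose A := [set z : R * R | (0 <= z.1 <= 2 * pi) /\ B0 z.2 /\ B1 (z.2 + tau z.1)].
have mtau : measurable_fun setT (fun z : R * R => z.2 + tau z.1).
  apply: measurable_funD => //; apply: (@measurableT_comp _ _ _ _ _ _ tau) => //.
  by apply: measurable_funB; apply: measurable_child_shift.
have mA : measurable A.
  have -> : A = [set z | `[0, 2 * pi]%classic z.1] `&`
      ([set z | B0 z.2] `&` [set z | B1 (z.2 + tau z.1)]).
    by apply/seteqP; split => z /=; rewrite in_itv.
  apply: measurableI; first exact: measurable_preimageT.
  by apply: measurableI; apply: measurable_preimageT.
have -> : (\int[lebesgue_measure]_(phi in `[0%R, (2 * pi)%R])
     lebesgue_measure [set x | B0 (x - child_shift rho phi theta ord0)%R /\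
                               B1 (x - child_shift rho phi theta child1)%R] =
   \int[lebesgue_measure]_phi lebesgue_measure (xsection A phi))%E.
  rewrite integral_mkcond; apply: eq_integral => phi _.
  rewrite patchE mem_setE in_itv /= xsection_setE /=.
  case: ifPn => phiD; last first.
    by rewrite [X in lebesgue_measure X](_ : _ = set0) ?measure0 // -subset0 => x [].
  rewrite -[RHS](lebesgue_measure_shift (child_shift rho phi theta ord0)).
  congr (lebesgue_measure _); apply/seteqP; split => x /=; rewrite /tau.
    by rewrite addrA subrK => -[].
  by rewrite addrA subrK => -[_ []].
rewrite measure_sections_swap // -ge0_integralZl //; last first.
- by rewrite lee_fin; lra.
- exact: measurable_fun_ysection.
rewrite muleC -integral_cst // integral_mkcond.
apply: ge0_le_integral => //.
- by move=> x _; rewrite erestrict_ge0.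
- by apply/(measurable_restrictT _ _).1 => //.
- by apply: measurable_funeM; exact: measurable_fun_ysection.
move=> x _; rewrite patchE; case: ifPn => xB0; last by rewrite mule_ge0 // lee_fin; lra.
rewrite /cst -(lebesgue_measure_shift (- x) B1).
rewrite ysection_setE /=; set F := [set phi : R | 0 <= phi <= 2 * pi /\ _].
apply: (@le_trans _ _ (lebesgue_measure (tau @` F))).
  apply: le_outer_measure => v /=; rewrite opprK => B1v.
  have xB : B0 x by move: xB0; rewrite inE.
  have vrho : `|v| <= rho.
    rewrite -(addrK x v) (le_trans (ler_normB _ _)) // (le_trans _ qrho) //.
    by rewrite mulr_natl mulr2n lerD //; [exact: B1q | exact: B0q].
  have [phi phiD phiv] := child_shift_diff_onto tpi vrho.
  by exists phi => //; rewrite /F /= /tau phiv addrC.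
apply: lebesgue_measure_lipschitz => [|a b _ _]; first by lra.
by apply: child_shift_diff_lipschitz; exact: ltW.
Qed.

(** * Compactness of the stages *)

Lemma cauchy_schwarz2 {R : realType} (a b c d r s : R) :
  0 <= r -> 0 <= s -> a ^+ 2 + b ^+ 2 <= r ^+ 2 -> c ^+ 2 + d ^+ 2 <= s ^+ 2 ->
  `|a * c + b * d| <= r * s.
Proof.
move=> r0 s0 ab cd; rewrite -[leRHS]ger0_norm ?mulr_ge0 // -ler_sqr ?nnegrE //.
rewrite !real_normK ?num_real // exprMn.
apply: (@le_trans _ _ ((a ^+ 2 + b ^+ 2) * (c ^+ 2 + d ^+ 2))).
  rewrite -subr_ge0 (_ : _ - _ = (a * d - b * c) ^+ 2) ?sqr_ge0 //; ring.
by apply: ler_pM => //; rewrite addr_ge0 // sqr_ge0.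
Qed.

Lemma discE {R : realType} (c : R * R) (r : R) (x : R * R) :
  0 <= r -> disc c r x <-> (x.1 - c.1) ^+ 2 + (x.2 - c.2) ^+ 2 <= r ^+ 2.
Proof.
move=> r0; rewrite /disc /=; set s := _ + _.
have s0 : 0 <= s by rewrite addr_ge0 // sqr_ge0.
by rewrite -[in X in X <-> _](ger0_norm r0) -sqrtr_sqr ler_sqrt ?sqr_ge0.
Qed.

Section geometry.
Context {R : realType} (r : nat -> R) (hr : admissible r).

Let r_ge0 n : 0 <= r n. Proof. exact: hr.1. Qed.
Let r_dec n : r n.+1 <= r n. Proof. exact: hr.2.1. Qed.

(** The displacement is [rho] times a unit vector, where [rho] is the difference
    of the radii; the square of the triangle inequality is expanded around the
    centre of the child. *)
Lemma subset_disc_child (omega : word -> R) (i : word) (c : R * R) (j : 'I_4) :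
  disc (child_center r omega i c j) (r (size i).+1) `<=` disc c (r (size i)).
Proof.
move=> x; rewrite !discE // /child_center /unit_vec /=.
set t := omega i + _; set rho := r (size i) - _.
have rho0 : 0 <= rho by rewrite subr_ge0.
rewrite !opprD !addrA; set a := x.1 - c.1; set b := x.2 - c.2 => h.
have := cauchy_schwarz2 (r_ge0 _) ler01 h.
move=> /(_ (cos t) (sin t)); rewrite cos2Dsin2 expr1n => /(_ (lexx _)).
rewrite mulr1 => /(le_trans (ler_norm _)) cs.
have -> : a ^+ 2 + b ^+ 2 = (a - rho * cos t) ^+ 2 + (b - rho * sin t) ^+ 2 +
    2 * rho * ((a - rho * cos t) * cos t + (b - rho * sin t) * sin t) +
    rho ^+ 2 * (cos t ^+ 2 + sin t ^+ 2) by ring.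
rewrite cos2Dsin2.
have -> : r (size i) ^+ 2 = r (size i).+1 ^+ 2 + 2 * rho * r (size i).+1 + rho ^+ 2 * 1.
  by rewrite /rho; ring.
by rewrite !lerD // ler_wpM2l // mulr_ge0.
Qed.

Lemma finite_words n : finite_set [set i : word | size i = n].
Proof.
have -> : [set i : word | size i = n] = range (fun t : n.-tuple 'I_4 => tval t).
  apply/seteqP; split => [i /eqP si|_ [t _ <-]]; last by rewrite /= size_tuple.
  by exists (Tuple si).
by apply: finite_image; exact: finite_finset.
Qed.

Lemma closed_disc (c : R * R) (s : R) : 0 <= s -> closed (disc c s).
Proof.
move=> s0.
have -> : disc c s = (fun x : R * R =>
    (x.1 - c.1) * (x.1 - c.1) + (x.2 - c.2) * (x.2 - c.2)) @^-1`
    [set y | y <= s ^+ 2].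
  by apply/seteqP; split => x /=; rewrite -!expr2 => /(discE _ _ s0).
apply: closed_comp; last exact: closed_le.
by move=> x _; apply: cvgD; apply: cvgM; apply: cvgB; try exact: cvg_cst;
  (exact: cvg_fst || exact: cvg_snd).
Qed.

Lemma closed_cantor_stage (omega : word -> R) n : closed (cantor_stage r omega n).
Proof.
by apply: closed_bigcup; [exact: finite_words | move=> i _; exact: closed_disc].
Qed.

Lemma cantor_stage_decr (omega : word -> R) m n :
  (m <= n)%N -> cantor_stage r omega n `<=` cantor_stage r omega m.
Proof.
elim: n => [|n IH]; first by rewrite leqn0 => /eqP ->.
rewrite leq_eqVlt => /predU1P[-> //|/IH]; apply: subset_trans.
move=> x [i /= si]; case/lastP: i si => // i j; rewrite size_rcons => -[si].
rewrite /cantor_disc center_rcons size_rcons => /subset_disc_child xi.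
by exists i.
Qed.

Lemma compact_cantor_stage0 (omega : word -> R) : compact (cantor_stage r omega 0).
Proof.
apply: (@subclosed_compact _ _ (`[- r 0, r 0] `*` `[- r 0, r 0])).
- exact: closed_cantor_stage.
- by apply: compact_setX; exact: segment_compact.
move=> x [i /= /eqP /nilP ->]; rewrite /cantor_disc discE //= !subr0 => h.
rewrite !in_itv /= -!ler_norml; split; rewrite -ler_sqr ?nnegrE //;
  rewrite real_normK ?num_real // (le_trans _ h) //.
  by rewrite lerDl sqr_ge0.
by rewrite lerDr sqr_ge0.
Qed.

Lemma continuous_linear_proj (theta : R) : continuous (linear_proj theta).
Proof.
by move=> x; apply: cvgD; apply: cvgM; try exact: cvg_cst;
  [exact: cvg_fst | exact: cvg_snd].
Qed.

(** A value attained on every stage is attained at the points of a sequence whose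
    cluster points, which exist by compactness, belong to all the stages. *)
Lemma image_linear_proj_cantor (omega : word -> R) (theta : R) :
  linear_proj theta @` cantor r omega =
  \bigcap_n (linear_proj theta @` cantor_stage r omega n).
Proof.
apply/seteqP; split=> [_ [x Kx <-] n _|y ybig]; first by exists x => //; exact: Kx.
have {}ybig n : exists x, cantor_stage r omega n x /\ linear_proj theta x = y.
  by have [x] := ybig n I; exists x.
have [x xP] := choice ybig.
have [] := @compact_cantor_stage0 omega (x @ \oo) _ _.
  by exists 0%N => // n _; apply: (cantor_stage_decr (leq0n n)); exact: (xP n).1.
move=> p [_ clp]; exists p.
  move=> n _; have cl := @closed_cantor_stage omega n.
  apply: (cl p) => B pB; apply: clp => //.
  by exists n => // m /= nm; apply: (cantor_stage_decr nm); exact: (xP m).1.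
have cl : closed (linear_proj theta @^-1` [set y]).
  by apply: closed_comp => [z _|]; [exact: continuous_linear_proj|exact: closed_eq].
apply: (cl p) => B pB; apply: clp => //.
by exists 0%N => // m _ /=; exact: (xP m).2.
Qed.

End geometry.

(** * Projections of the stages *)

(** The projection in direction [theta] of the part of stage [size i + m] below
    the word [i], translated so that the centre of the disc of [i] is sent to
    the origin. *)
Fixpoint proj_stage {R : realType} (r : nat -> R) (omega : word -> R)
    (theta : R) (i : word) (m : nat) : set R :=
  if m is m'.+1 then
    [set x | exists j : 'I_4, proj_stage r omega theta (rcons i j) m'
       (x - child_shift (r (size i) - r (size i).+1) (omega i) theta j)]
  else [set x | `|x| <= r (size i)].

Lemma linear_proj_child {R : realType} (r : nat -> R) (omega : word -> R)
    (theta : R) (i : word) (c : R * R) (j : 'I_4) :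
  linear_proj theta (child_center r omega i c j) =
  linear_proj theta c +
    child_shift (r (size i) - r (size i).+1) (omega i) theta j.
Proof. by rewrite /linear_proj /child_shift cosB /=; ring. Qed.

Lemma proj_stageP {R : realType} (r : nat -> R) (omega : word -> R)
    (theta : R) (i : word) (c : R * R) (m : nat) (x : R) :
  proj_stage r omega theta i m (x - linear_proj theta c) <->
  exists2 s : word, size s = m &
    `|x - linear_proj theta (center_from r omega i c s)| <= r (size i + m)%N.
Proof.
elim: m i c x => [|m IH] i c x /=.
  rewrite addn0; split=> [h|[s /eqP /nilP -> //]]; first by exists [::].
split=> [[j]|[[//|j s] [sm] h]].
  rewrite -addrA -opprD -linear_proj_child IH => -[s sm].
  by rewrite size_rcons addSnnS => h; exists (j :: s) => //=; rewrite sm.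
exists j; rewrite -addrA -opprD -linear_proj_child IH.
by exists s => //; rewrite size_rcons addSnnS.
Qed.

Section projected_stages.
Context {R : realType} (r : nat -> R) (hr : admissible r).

Let r_ge0 n : 0 <= r n. Proof. exact: hr.1. Qed.
Let r_dec n : r n.+1 <= r n. Proof. exact: hr.2.1. Qed.

(** The projection of a disc is the whole interval, not merely a part of it: a
    preimage is found on the line through the centre in direction [theta]. *)
Lemma image_linear_proj_stage (omega : word -> R) (theta : R) n :
  linear_proj theta @` cantor_stage r omega n = proj_stage r omega theta [::] n.
Proof.
have pE x : proj_stage r omega theta [::] n x <->
    exists2 s : word, size s = n & `|x - linear_proj theta (Defs.center r omega s)| <= r n.
  by rewrite -[x in proj_stage _ _ _ _ _ x](subr0 x)
    -[X in _ - X](_ : linear_proj theta (0, 0) = 0)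
    ?proj_stageP //= /linear_proj !mul0r addr0.
apply/seteqP; split=> [_ [x [i /= si] xi <-]|y /pE[i si yi]].
  apply/pE; exists i => //; move: xi; rewrite /cantor_disc discE // si => xi.
  rewrite (_ : _ - _ = (x.1 - (Defs.center r omega i).1) * cos theta +
    (x.2 - (Defs.center r omega i).2) * sin theta); last by rewrite /linear_proj; ring.
  rewrite -[leRHS]mulr1; apply: cauchy_schwarz2 => //.
  by rewrite cos2Dsin2 expr1n.
set c := Defs.center r omega i in yi; set t := y - linear_proj theta c in yi.
exists (c.1 + t * cos theta, c.2 + t * sin theta).
  exists i => //; rewrite /cantor_disc discE // si /= -/c.
  rewrite (addrAC c.1) (addrAC c.2) !subrr !add0r !exprMn -mulrDr.
  rewrite cos2Dsin2 mulr1.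
  by rewrite -[leLHS]real_normK ?num_real // ler_sqr ?nnegrE.
rewrite /linear_proj /= [LHS](_ : _ = linear_proj theta c +
  t * (cos theta ^+ 2 + sin theta ^+ 2)); last by rewrite /linear_proj; ring.
by rewrite cos2Dsin2 mulr1 /t addrC subrK.
Qed.

Lemma proj_stage_bounded (omega : word -> R) (theta : R) i m x :
  proj_stage r omega theta i m x -> `|x| <= r (size i).
Proof.
elim: m i x => [//|m IH] i x /= [j /IH]; rewrite size_rcons.
set rho := r (size i) - _ => h.
rewrite -(subrK (child_shift rho (omega i) theta j) x).
rewrite (le_trans (ler_normD _ _)) // -[leRHS](subrKC (r (size i).+1)) lerD //.
by rewrite normrM ger0_norm ?subr_ge0 // ler_piMr ?cos_max ?subr_ge0.
Qed.

Lemma proj_stage_decr (omega : word -> R) (theta : R) i m n :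
  (m <= n)%N -> proj_stage r omega theta i n `<=` proj_stage r omega theta i m.
Proof.
elim: m n i => [|m IH] [|n] i mn x; try exact: proj_stage_bounded.
  by [].
rewrite /=.
by move=> [j xj]; exists j; exact: (IH n _ mn _ xj).
Qed.

Lemma image_linear_proj_cantorE (omega : word -> R) (theta : R) :
  linear_proj theta @` cantor r omega =
  \bigcap_n proj_stage r omega theta [::] n.
Proof.
rewrite image_linear_proj_cantor //; apply: eq_bigcapr => n _.
exact: image_linear_proj_stage.
Qed.

End projected_stages.

(** Stated for angles and direction that are functions on an arbitrary measurable
    space: it serves for a fixed configuration with varying direction, for random
    angles in a fixed direction, and for both at once. *)
Lemma measurable_proj_stage {d} {T : measurableType d} {R : realType}
    (r : nat -> R) (w : word -> T -> R) (theta : T -> R) (i : word) (m : nat) :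
  (forall s, (size s < m)%N -> measurable_fun setT (w (i ++ s))) ->
  measurable_fun setT theta ->
  measurable [set z : T * R |
    proj_stage r (fun s => w s z.1) (theta z.1) i m z.2].
Proof.
move=> + mt; elim: m i => [|m IH] i mw /=.
  rewrite (_ : mkset _ = [set z : T * R | `[- r (size i), r (size i)]%classic z.2]).
    exact: measurable_preimageT.
  by apply/seteqP; split => z /=; rewrite in_itv /= ler_norml.
rewrite (_ : mkset _ = \bigcup_(j in [set: 'I_4]) [set z : T * R |
    [set z | proj_stage r (fun s => w s z.1) (theta z.1) (rcons i j) m z.2]
    (z.1, z.2 - child_shift (r (size i) - r (size i).+1) (w i z.1) (theta z.1) j)]).
  apply: fin_bigcup_measurable => // j _; apply: measurable_preimageT; last first.
    by apply: IH => s sm; rewrite cat_rcons; exact: mw.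
  apply: measurable_fun_pair => //; apply: measurable_funB => //.
  apply: (measurable_child_shift _ _ (w := w i \o fst) (theta := theta \o fst)).
    by apply: measurableT_comp => //; rewrite -[i]cats0; exact: mw.
  exact: measurableT_comp.
by apply/seteqP; split => z /= [j]; [exists j | move=> _ ?; exists j].
Qed.

(** * Transversality and separation of the centres *)

(** By the double angle formula and the mean value theorem [sin x] is [x] times a
    product of two cosines of angles at most [pi / 4]. *)
Lemma ge_half_sin {R : realType} (x : R) : 0 <= x <= pi / 2 -> x / 2 <= sin x.
Proof.
move=> /andP[x0 xpi]; have p0 := @pi_gt0 R.
have cosD_ge (y : R) : 0 <= y <= x / 2 -> 2^-1 <= cos y ^+ 2.
  move=> /andP[y0 yx]; have : 0 <= cos (y *+ 2).
    by apply: cos_ge0_pihalf; rewrite (mulr2n y); lra.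
  by rewrite cos_mulr2n (mulr2n (cos y ^+ 2)); lra.
have [c] := @MVT_segment R sin cos 0 (x / 2) ltac:(lra)
  (fun z _ => is_derive_sin z) (continuous_subspaceT (@continuous_sin R)).
rewrite sin0 !subr0 in_itv /= => cx sE.
have c2 := cosD_ge _ cx.
have x2 : 2^-1 <= cos (x / 2) ^+ 2 by apply: cosD_ge; lra.
have pos y : 0 <= y <= x / 2 -> 0 <= cos y by move=> ?; apply: cos_ge0_pihalf; lra.
have c0 := pos _ cx; have x20 : 0 <= cos (x / 2) by apply: pos; lra.
have xE : x = (x / 2) *+ 2 by rewrite (mulr2n (x / 2)); lra.
rewrite {2}xE sin_mulr2n sE mulrA [leRHS]mulr2n.
have : 2^-1 <= cos (x / 2) * cos c.
  rewrite -ler_sqr ?nnegrE ?mulr_ge0 ?invr_ge0 // exprMn [leLHS]expr2.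
  by rewrite ler_pM ?invr_ge0.
move=> h.
have : 2^-1 * (x / 2) <= cos (x / 2) * cos c * (x / 2) by rewrite ler_wpM2r // divr_ge0.
by lra.
Qed.

(** Two directions almost orthogonal to the same vector differ by a small angle
    modulo [pi]: express the vector through its two projections [x] and [y] and
    estimate its norm.  So the whole set is close, modulo [pi], to any of its
    points. *)
Lemma measure_almost_orthogonal {R : realType} (a b rho e : R) :
  0 < rho -> rho ^+ 2 <= a ^+ 2 + b ^+ 2 -> 0 <= e ->
  (lebesgue_measure [set theta : R | (0 <= theta <= pi)%R /\
     (`|a * cos theta + b * sin theta| <= e)%R] <= (16 * e / rho)%:E)%E.
Proof.
move=> rho0 rhoab e0; set Z := [set theta | _].
have L0 : 0 <= 4 * e / rho by rewrite divr_ge0 ?mulr_ge0 // ltW.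
have [->|/set0P[t0 [t0pi t0e]]] := eqVneq Z set0.
  by rewrite measure0 lee_fin divr_ge0 ?mulr_ge0 // ltW.
have close t : Z t -> `|t - t0| <= 4 * e / rho \/ pi - `|t - t0| <= 4 * e / rho.
  move=> [tpi te].
  have tt0 : `|t - t0| <= pi by rewrite ler_norml; lra.
  have sinle : rho * sin `|t - t0| <= 2 * e.
    rewrite -ler_sqr ?nnegrE ?mulr_ge0 ?(ltW rho0) // ?sin_ge0_pi ?normr_ge0 //.
    rewrite exprMn.
    have -> : sin `|t - t0| ^+ 2 = (sin t * cos t0 - cos t * sin t0) ^+ 2.
      by rewrite -sinB; case: (ger0P (t - t0)) => _; rewrite // sinN sqrrN.
    apply: le_trans (_ : (a ^+ 2 + b ^+ 2) *
        (sin t * cos t0 - cos t * sin t0) ^+ 2 <= _).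
      by rewrite ler_wpM2r // sqr_ge0.
    set x := a * cos t + b * sin t in te.
    set y := a * cos t0 + b * sin t0 in t0e.
    have -> : (a ^+ 2 + b ^+ 2) * (sin t * cos t0 - cos t * sin t0) ^+ 2 =
        (y * sin t - x * sin t0) ^+ 2 + (x * cos t0 - y * cos t) ^+ 2.
      by rewrite /x /y; ring.
    have -> : (y * sin t - x * sin t0) ^+ 2 + (x * cos t0 - y * cos t) ^+ 2 =
        y ^+ 2 * (cos t ^+ 2 + sin t ^+ 2) + x ^+ 2 * (cos t0 ^+ 2 + sin t0 ^+ 2)
        - 2 * (x * y) * (cos t * cos t0 + sin t * sin t0) by ring.
    rewrite -cosB !cos2Dsin2 !mulr1.
    have x2 : x ^+ 2 <= e ^+ 2 by rewrite -[leLHS]real_normK ?num_real // ler_sqr ?nnegrE.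
    have y2 : y ^+ 2 <= e ^+ 2 by rewrite -[leLHS]real_normK ?num_real // ler_sqr ?nnegrE.
    have : `|x * y * cos (t - t0)| <= e ^+ 2.
      rewrite normrM -[leRHS]mulr1 ler_pM ?normr_ge0 ?cos_max // normrM expr2.
      by rewrite ler_pM.
    by rewrite ler_norml; lra.
  have half s : 0 <= s <= pi / 2 -> rho * sin s <= 2 * e -> s <= 4 * e / rho.
    move=> s0 se; have := ge_half_sin s0; rewrite ler_pdivlMr // => h.
    have : rho * (s / 2) <= rho * sin s by rewrite ler_pM2l.
    by lra.
  have [small|big] := leP `|t - t0| (pi / 2).
    by left; apply: half => //; rewrite normr_ge0.
  right; apply: half; first by lra.
  by rewrite addrC sinDpi sinN opprK.
set L := 4 * e / rho in L0 close.
have sub : Z `<=` (`[t0 - L, t0 + L] : set R) `|`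
    ((`[t0 + (pi - L), t0 + pi] : set R) `|` (`[t0 - pi, t0 - (pi - L)] : set R)).
  move=> t Zt /=; rewrite !in_itv /=; have [tpi _] := Zt.
  case: (close _ Zt); first by rewrite ler_norml => ?; left; lra.
  by case: (ger0P (t - t0)) => _ ?; right; [left|right]; lra.
apply: (le_trans (le_outer_measure (@lebesgue_measure R) _ _ sub)).
apply: (le_trans (outer_measureU2 (@lebesgue_measure R) _ _)).
have itvle (x y z : R) : x <= y -> y - x <= z ->
    (lebesgue_measure (`[x, y] : set R) <= z%:E)%E.
  move=> xy xyz; rewrite lebesgue_measure_itv /= lte_fin; case: ifPn => _.
    by rewrite -EFinB lee_fin.
  by rewrite lee_fin; lra.
apply: (@le_trans _ _ ((2 * L)%:E + (L%:E + L%:E))%E); last first.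
  by rewrite -!EFinD lee_fin /L; lra.
apply: leeD; first by apply: itvle; lra.
apply: (le_trans (outer_measureU2 (@lebesgue_measure R) _ _)).
by apply: leeD; apply: itvle; lra.
Qed.

Section separation.
Context {R : realType} (r : nat -> R) (hr : admissible r).

Let r_ge0 n : 0 <= r n. Proof. exact: hr.1. Qed.
Let r_dec n : r n.+1 <= r n. Proof. exact: hr.2.1. Qed.

(** The displacements from a centre to its descendants telescope; testing against
    the vector [(a, b)] avoids the Euclidean norm on the left-hand side. *)
Lemma center_from_dev (omega : word -> R) (a b e : R) (i : word) (c : R * R) s :
  0 <= e -> a ^+ 2 + b ^+ 2 <= e ^+ 2 ->
  `|a * ((center_from r omega i c s).1 - c.1) +
    b * ((center_from r omega i c s).2 - c.2)| <=
  e * (r (size i) - r (size i + size s)%N).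
Proof.
move=> e0 abe; elim: s i c => [|j s IH] i c /=.
  by rewrite addn0 !subrr !mulr0 addr0 normr0.
set c' := child_center r omega i c j.
set x := center_from r omega _ c' s.
rewrite (_ : _ + _ = (a * (x.1 - c'.1) + b * (x.2 - c'.2)) +
  (r (size i) - r (size i).+1) * (a * cos (omega i + 2 * pi * j%:R / 4) +
    b * sin (omega i + 2 * pi * j%:R / 4))); last first.
  by rewrite /c' /child_center /unit_vec /=; ring.
have := IH (rcons i j) c'; rewrite size_rcons addSnnS -/x => h.
rewrite (le_trans (ler_normD _ _)) //.
rewrite [leRHS](_ : _ = e * (r (size i).+1 - r (size i + (size s).+1)%N) +
  (r (size i) - r (size i).+1) * (e * 1)); last by ring.
rewrite lerD // normrM ger0_norm ?subr_ge0 // ler_wpM2l ?subr_ge0 //.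
by apply: cauchy_schwarz2 => //; rewrite cos2Dsin2 expr1n.
Qed.

Lemma child_center_dist (omega : word -> R) (i : word) (c : R * R) (j k : 'I_4) :
  j != k ->
  2 * (r (size i) - r (size i).+1) ^+ 2 <=
  ((child_center r omega i c j).1 - (child_center r omega i c k).1) ^+ 2 +
  ((child_center r omega i c j).2 - (child_center r omega i c k).2) ^+ 2.
Proof.
move=> jk; rewrite /child_center /unit_vec /=.
set rho := r _ - r _; set s := omega i + _; set t := omega i + _.
rewrite [leRHS](_ : _ = rho ^+ 2 * ((cos s ^+ 2 + sin s ^+ 2) +
  (cos t ^+ 2 + sin t ^+ 2) - 2 * (cos s * cos t + sin s * sin t))); last by ring.
rewrite -cosB !cos2Dsin2.
suff : cos (s - t) <= 0.
  move=> st; rewrite mulrC ler_wpM2l ?sqr_ge0 //; lra.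
have {s t} -> : s - t = (j%:R - k%:R) * (pi / 2) by rewrite /s /t; field.
wlog jltk : j k jk / (k < j)%N.
  move=> h; have [kj|jk'|/val_inj jkE] := ltngtP k j; first exact: h.
    by rewrite -opprB mulNr cosN h // eq_sym.
  by rewrite jkE eqxx in jk.
have c1 : cos (pi / 2 : R) = 0 := cos_pihalf R.
rewrite -natrB; last exact: ltnW.
have : (0 < j - k < 4)%N by rewrite subn_gt0 jltk (leq_ltn_trans (leq_subr _ _)).
case: (j - k)%N => [|[|[|[|//]]]] // _.
- by rewrite mul1r c1.
- by rewrite (_ : 2%:R * (pi / 2) = pi :> R) ?cospi ?lerN10 //; field.
- rewrite (_ : 3%:R * (pi / 2) = pi / 2 + pi :> R); last by field.
  by rewrite cosDpi c1 oppr0.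
Qed.

(** The centres of two siblings are at distance [d >= sqrt 2 * (p - q)], with [p]
    and [q] the radii of the parent and of the children, and their descendants move
    by at most [q] each.  As [q <= p / 3], the distance that remains is at least
    [(2 / 3) * (sqrt 2 - 1) * p >= p / 4]. *)
Lemma center_from_separated (omega : word -> R) (i : word) (c : R * R)
    (j k : 'I_4) (s t : word) (x y : R * R) :
  0 < r (size i) -> j != k ->
  x = center_from r omega (rcons i j) (child_center r omega i c j) s ->
  y = center_from r omega (rcons i k) (child_center r omega i c k) t ->
  (r (size i) / 4) ^+ 2 <= (x.1 - y.1) ^+ 2 + (x.2 - y.2) ^+ 2.
Proof.
move=> ri0 jk.
set cj := child_center r omega i c j; set ck := child_center r omega i c k.
move=> xE yE.
have := child_center_dist omega i c jk; rewrite -/cj -/ck.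
set v1 := cj.1 - ck.1; set v2 := cj.2 - ck.2 => v2rho.
have r3 := hr.2.2 (size i); have r1 := r_ge0 (size i).+1.
set p := r (size i) in ri0 r3 v2rho *; set q := r (size i).+1 in r1 r3 v2rho *.
pose d := Num.sqrt (v1 ^+ 2 + v2 ^+ 2).
have d0 : 0 <= d := sqrtr_ge0 _.
have dE : d ^+ 2 = v1 ^+ 2 + v2 ^+ 2 by rewrite sqr_sqrtr // addr_ge0 // sqr_ge0.
(* [14 / 10] is a lower bound for the square root of 2. *)
have dge : 14 / 10 * (p - q) <= d.
  rewrite -ler_sqr ?nnegrE //; last by lra.
  rewrite dE (le_trans _ v2rho) // exprMn ler_wpM2r ?sqr_ge0 //; lra.
have d_gt0 : 0 < d by lra.
have vd : v1 ^+ 2 + v2 ^+ 2 <= d ^+ 2 by rewrite dE.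
have hx : `|v1 * (x.1 - cj.1) + v2 * (x.2 - cj.2)| <= d * q.
  rewrite xE; apply: (le_trans (center_from_dev omega (rcons i j) cj s d0 vd)).
  by rewrite ler_wpM2l // size_rcons lerBlDr lerDl.
have hy : `|v1 * (y.1 - ck.1) + v2 * (y.2 - ck.2)| <= d * q.
  rewrite yE; apply: (le_trans (center_from_dev omega (rcons i k) ck t d0 vd)).
  by rewrite ler_wpM2l // size_rcons lerBlDr lerDl.
pose S := Num.sqrt ((x.1 - y.1) ^+ 2 + (x.2 - y.2) ^+ 2).
have S0 : 0 <= S := sqrtr_ge0 _.
have SE : S ^+ 2 = (x.1 - y.1) ^+ 2 + (x.2 - y.2) ^+ 2.
  by rewrite sqr_sqrtr // addr_ge0 // sqr_ge0.
have hS : `|v1 * (x.1 - y.1) + v2 * (x.2 - y.2)| <= d * S.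
  by apply: cauchy_schwarz2 => //; rewrite SE.
have E : v1 * (x.1 - y.1) + v2 * (x.2 - y.2) =
    d ^+ 2 + (v1 * (x.1 - cj.1) + v2 * (x.2 - cj.2)) -
    (v1 * (y.1 - ck.1) + v2 * (y.2 - ck.2)).
  by rewrite dE /v1 /v2; ring.
have : d * (d - 2 * q) <= d * S.
  move: hx hy hS; rewrite E !ler_norml; nra.
rewrite ler_pM2l // => dS.
by rewrite -SE ler_sqr ?nnegrE //; lra.
Qed.

End separation.

(** * Counting pairs of discs with overlapping projections *)

Fixpoint words (n : nat) : seq word :=
  if n is n'.+1 then [seq j :: s | j <- enum 'I_4, s <- words n'] else [:: [::]].

Lemma mem_words n (s : word) : (s \in words n) = (size s == n).
Proof.
elim: n s => [|n IH] s; first by case: s.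
apply/allpairsP/eqP => [[[j t] [/= _]]|]; first by rewrite IH => /eqP <- ->.
case: s => // j s [sn]; exists (j, s); split => //=; first by rewrite mem_enum.
by rewrite IH sn.
Qed.

Lemma size_words n : size (words n) = (4 ^ n)%N.
Proof.
by elim: n => // n IH; rewrite size_allpairs IH size_enum_ord expnS.
Qed.

Lemma big_words {R : Type} {idx : R} {op : Monoid.com_law idx} n (F : word -> R) :
  \big[op/idx]_(s <- words n.+1) F s =
  \big[op/idx]_(j : 'I_4) \big[op/idx]_(s <- words n) F (j :: s).
Proof. by rewrite [words _]/= big_allpairs_dep big_enum.  Qed.

Section pairs.
Context {R : realType} (r : nat -> R) (hr : admissible r).
Context (r_gt0 : forall n, 0 < r n).
Context (omega : word -> R).

Definition overlap_directions (s : R) (x y : R * R) : set R :=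
  [set theta | (0 <= theta <= pi) /\
     `|linear_proj theta x - linear_proj theta y| <= 2 * s].

Lemma measure_overlap_directions (rho s : R) (x y : R * R) :
  0 < rho -> 0 <= s -> rho ^+ 2 <= (x.1 - y.1) ^+ 2 + (x.2 - y.2) ^+ 2 ->
  (lebesgue_measure (overlap_directions s x y) <= (32 * s / rho)%:E)%E.
Proof.
move=> rho0 s0 xy; have := measure_almost_orthogonal rho0 xy (_ : 0 <= 2 * s).
rewrite (_ : 32 * s / rho = 16 * (2 * s) / rho); last by field; rewrite gt_eqF.
rewrite (_ : overlap_directions s x y = [set theta | 0 <= theta <= pi /\
  `|(x.1 - y.1) * cos theta + (x.2 - y.2) * sin theta| <= 2 * s]).
  by apply; rewrite mulr_ge0.
apply/seteqP; split => t; rewrite /overlap_directions /linear_proj /=;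
 by rewrite (_ : x.1 * _ + _ - _ = (x.1 - y.1) * cos t + (x.2 - y.2) * sin t) //; ring.
Qed.

Lemma overlap_directions_le_pi (s : R) (x y : R * R) :
  (lebesgue_measure (overlap_directions s x y) <= pi%:E)%E.
Proof.
apply: (@le_trans _ _ (lebesgue_measure (`[0, pi] : set R))).
  by apply: le_outer_measure => t [tpi _]; rewrite /= in_itv.
by rewrite lebesgue_measure_itv /= lte_fin pi_gt0 oppr0 addr0.
Qed.

(** Induction on the first letter: pairs with the same first letter are handled
    by the induction hypothesis, the others are separated by
    [center_from_separated].  The first term accounts for the diagonal. *)
Lemma sum_overlap_directions i c m :
  (\sum_(s <- words m) \sum_(t <- words m)
     lebesgue_measure (overlap_directions (r (size i + m)%N)
       (center_from r omega i c s) (center_from r omega i c t)) <=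
   (4 ^+ m * pi + 16 ^+ m * (128 * r (size i + m)%N *
      \sum_(0 <= l < m) (4 ^- l / r (size i + l)%N)))%:E)%E.
Proof.
elim: m i c => [|m IH] i c.
  rewrite !big_seq1 big_geq // expr0 mul1r !mulr0 addr0.
  exact: overlap_directions_le_pi.
rewrite big_words; under eq_bigr do under eq_bigr do rewrite big_words.
set n := (size i + m.+1)%N.
pose x j s := center_from r omega (rcons i j) (child_center r omega i c j) s.
pose D := 16 ^+ m * (128 * r n / r (size i)).
pose B := 4 ^+ m * pi + 16 ^+ m * (128 * r n *
      \sum_(0 <= l < m) (4 ^- l / r (size i + l.+1)%N)).
have diag j : (\sum_(s <- words m) \sum_(t <- words m)
    lebesgue_measure (overlap_directions (r n) (x j s) (x j t)) <= B%:E)%E.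
  have := IH (rcons i j) (child_center r omega i c j).
  rewrite size_rcons addSnnS /B.
  rewrite [\sum_(0 <= l < m) _](eq_bigr (fun l => 4 ^- l / r (size i + l.+1)%N)) //.
  by move=> l _; rewrite addSnnS.
have off j k : j != k -> (\sum_(s <- words m) \sum_(t <- words m)
    lebesgue_measure (overlap_directions (r n) (x j s) (x k t)) <= D%:E)%E.
  move=> jk.
  apply: (@le_trans _ _ (\sum_(s <- words m) \sum_(t <- words m)
      (128 * r n / r (size i))%:E)%E).
    apply: lee_sum => s _; apply: lee_sum => t _.
    rewrite (_ : 128 * r n / r (size i) = 32 * r n / (r (size i) / 4)); last first.
      by field; rewrite gt_eqF.
    apply: measure_overlap_directions; rewrite ?divr_gt0 ?(ltW (r_gt0 _)) //.
    exact: (center_from_separated hr (r_gt0 _) jk).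
  under eq_bigr do rewrite sumEFin.
  rewrite sumEFin lee_fin !big_const_seq !count_predT size_words !iter_addr_0.
  rewrite -mulrnA -[leLHS]mulr_natl /D (_ : (4 ^ m * 4 ^ m)%N%:R = 16 ^+ m :> R) //.
  by rewrite -expnMn natrX.
apply: (@le_trans _ _ (\sum_(j : 'I_4) (B + 3 * D)%:E)%E).
  apply: lee_sum => j _; rewrite exchange_big /= (bigD1 j) //= EFinD.
  apply: leeD; first exact: diag.
  apply: (@le_trans _ _ (\sum_(k : 'I_4 | k != j) D%:E)%E).
    by apply: lee_sum => k kj; apply: off; rewrite eq_sym.
  rewrite sumEFin lee_fin sumr_const cardC1 card_ord mulr_natl //.
rewrite sumEFin lee_fin sumr_const card_ord.
have D0 : 0 <= D by rewrite !mulr_ge0 ?exprn_ge0 ?invr_ge0 // ltW.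
apply: (@le_trans _ _ ((B + 4 * D) *+ 4)); first by rewrite lerMn2r /=; lra.
rewrite big_nat_recl // expr0 invr1 mul1r addn0.
have -> : \sum_(0 <= l < m) (4 ^- l.+1 / r (size i + l.+1)%N) =
    4^-1 * \sum_(0 <= l < m) (4 ^- l / r (size i + l.+1)%N).
  rewrite mulr_sumr; apply: eq_bigr => l _.
  by rewrite exprS invfM mulrA.
rewrite /B /D; set s := \sum_(0 <= l < m) _.
rewrite !exprS le_eqVlt; apply/orP; left; apply/eqP.
by field; rewrite gt_eqF.
Qed.

End pairs.

(** * Second moment lower bound *)

(** Integrate the inequality [2 * N <= a + N ^ 2 / a] over [A], where [N] counts
    the sets that contain a point.  Keeping [a] free gives a linear form of the
    Cauchy-Schwarz inequality, which can be integrated once more over the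
    directions before [a] is chosen. *)
Lemma second_moment_bound {d} {T : measurableType d} {R : realType}
    (mu : {measure set T -> \bar R}) (I : eqType) (L : seq I) (J : I -> set T)
    (A : set T) (a : R) :
  0 < a -> (forall i, measurable (J i)) -> measurable A ->
  (forall i, i \in L -> J i `<=` A) ->
  (2%:E * (\sum_(i <- L) mu (J i)) <=
   a%:E * mu A + a^-1%:E * \sum_(i <- L) \sum_(j <- L) mu (J i `&` J j))%E.
Proof.
move=> a0 mJ mA JA.
have ai0 : 0 <= a^-1 by rewrite invr_ge0 ltW.
have mind (B : set T) : measurable B ->
    measurable_fun setT (fun x => (\1_B x : R)%:E).
  by move=> mB; apply/measurable_EFinP.
have ind0 (B : set T) x : (0 <= (\1_B x : R)%:E)%E by rewrite lee_fin.
have sum1 : (\sum_(i <- L) mu (J i) = \int[mu]_x \sum_(i <- L) (\1_(J i) x)%:E)%E.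
  rewrite ge0_integral_sum //; last by move=> i; exact: mind.
  by apply: eq_bigr => i _; rewrite integral_indic // setIT.
have mJJ i j : measurable (J i `&` J j) by exact: measurableI.
have sum2 : (\sum_(i <- L) \sum_(j <- L) mu (J i `&` J j) =
    \int[mu]_x \sum_(i <- L) \sum_(j <- L) (\1_(J i `&` J j) x)%:E)%E.
  rewrite ge0_integral_sum //.
  - apply: eq_bigr => i _; rewrite ge0_integral_sum //.
      by apply: eq_bigr => j _; rewrite integral_indic // setIT.
    by move=> j; exact: mind.
  - by move=> i; apply: emeasurable_sum => j; exact: mind.
  - by move=> i x _; apply: sume_ge0.
have m1 : measurable_fun setT (fun x => \sum_(i <- L) (\1_(J i) x : R)%:E)%E.
  by apply: emeasurable_sum => i; exact: mind.
have m2 : measurable_fun setT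
    (fun x => \sum_(i <- L) \sum_(j <- L) (\1_(J i `&` J j) x : R)%:E)%E.
  by apply: emeasurable_sum => i; apply: emeasurable_sum => j; exact: mind.
have p1 x : (0 <= \sum_(i <- L) (\1_(J i) x : R)%:E)%E by apply: sume_ge0.
have p2 x : (0 <= \sum_(i <- L) \sum_(j <- L) (\1_(J i `&` J j) x : R)%:E)%E.
  by apply: sume_ge0 => i _; apply: sume_ge0.
have -> : mu A = (\int[mu]_x (\1_A x)%:E)%E by rewrite integral_indic // setIT.
rewrite sum1 sum2 -!ge0_integralZl ?lee_fin ?(ltW a0) //; last exact: mind.
rewrite -ge0_integralD //; last 4 first.
- by move=> x _; apply: mule_ge0; rewrite lee_fin // ltW.
- by apply: measurable_funeM; exact: mind.
- by move=> x _; apply: mule_ge0; rewrite ?lee_fin.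
- exact: measurable_funeM.
apply: ge0_le_integral => //.
- by move=> x _; rewrite mule_ge0.
- exact: measurable_funeM.
- by apply: emeasurable_funD; apply: measurable_funeM => //; exact: mind.
move=> x _; under [in leRHS]eq_bigr do rewrite sumEFin.
rewrite !sumEFin -!EFinM -EFinD lee_fin.
set N := \sum_(i <- L) _.
have -> : \sum_(i <- L) \sum_(j <- L) \1_(J i `&` J j) x = N ^+ 2 :> R.
  rewrite expr2 /N mulr_suml; apply: eq_bigr => i _; rewrite mulr_sumr.
  by apply: eq_bigr => j _; rewrite indicI.
have [xA|xA] := boolP (x \in A); last first.
  have -> : N = 0.
    rewrite /N big_seq big1 // => i iL; rewrite indicE memNset // => xi.
    by move: xA; rewrite notin_setE; apply; exact: JA xi.
  by rewrite expr0n /= !mulr0 addr0 mulr_ge0 ?ler0n // ltW.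
rewrite indicE xA mulr1 -subr_ge0.
rewrite (_ : _ - _ = a^-1 * (N - a) ^+ 2); last by field; rewrite gt_eqF.
by rewrite mulr_ge0 // sqr_ge0.
Qed.

Lemma measurable_linear_proj {R : realType} (x : R * R) :
  measurable_fun setT (fun theta => linear_proj theta x).
Proof.
apply: measurable_funD; apply: measurable_funM => //.
  exact: (continuous_measurable_fun (@continuous_cos R)).
exact: (continuous_measurable_fun (@continuous_sin R)).
Qed.

Lemma lebesgue_measure_0pi {R : realType} :
  lebesgue_measure (`[0, pi] : set R) = pi%:E.
Proof. by rewrite lebesgue_measure_itv /= lte_fin pi_gt0 oppr0 addr0. Qed.

Section favard_stage.
Context {R : realType} (r : nat -> R) (hr : admissible r) (omega : word -> R).

(** The pairs (direction, value) such that the line they determine meets the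
    stage. *)
Definition stage_lines (n : nat) : set (R * R) :=
  [set z | proj_stage r omega z.1 [::] n z.2].

Lemma measurable_stage_lines n : measurable (stage_lines n).
Proof.
apply: (@measurable_proj_stage _ _ R r (fun s _ => omega s) idfun [::] n).
  by move=> s _; exact: measurable_cst.
exact: measurable_id.
Qed.

Lemma xsection_stage_lines n theta :
  xsection (stage_lines n) theta = proj_stage r omega theta [::] n.
Proof. by rewrite xsection_setE. Qed.

Definition Fav_stage (n : nat) : \bar R :=
  (\int[lebesgue_measure]_(theta in `[0%R, pi])
     lebesgue_measure (proj_stage r omega theta [::] n))%E.

Lemma measurable_proj_stage_measure n :
  measurable_fun setT
    (fun theta => lebesgue_measure (proj_stage r omega theta [::] n)).
Proof.
have := measurable_fun_xsection (@lebesgue_measure R) (measurable_stage_lines n).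
by apply: eq_measurable_fun => theta _ /=; rewrite xsection_stage_lines.
Qed.

Lemma measurable_proj_stage_fixed theta i n :
  measurable (proj_stage r omega theta i n).
Proof.
have := measurable_xsection theta
  (@measurable_proj_stage _ _ R r (fun s _ => omega s) idfun i n
    (fun s _ => measurable_cst _) (@measurable_id _ _ _)).
by rewrite xsection_setE.
Qed.

Lemma lebesgue_measure_segment (c s : R) : 0 <= s ->
  lebesgue_measure [set x : R | `|x - c| <= s] = (2 * s)%:E.
Proof.
move=> s0; rewrite (_ : mkset _ = `[c - s, c + s]%classic).
  rewrite lebesgue_measure_itv /= lte_fin; case: ifPn => [_|].
    by rewrite -EFinB; congr EFin; ring.
  by rewrite -leNgt => h; congr EFin; lra.
by apply/seteqP; split => x /=; rewrite in_itv /= ler_distl.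
Qed.

(** [second_moment_bound] for the projected discs in each direction, integrated
    over the directions with [sum_overlap_directions]. *)
Lemma Fav_stage_lower_bound (S : R) n :
  (forall n, 0 < r n) ->
  (forall n, \sum_(0 <= l < n) (4 ^- l / r l) <= S) ->
  ((pi ^+ 2 / (64 * S))%:E <= Fav_stage n)%E.
Proof.
move=> r_gt0 hS.
have pi0 := @pi_gt0 R.
have S0 : 0 < S.
  by apply: lt_le_trans (hS 1%N); rewrite big_nat1 expr0 invr1 mul1r invr_gt0.
(* With this value of [b] the second moment term is half of the left-hand side
   of [int_le] below, and is absorbed by it. *)
pose b := 128 * S / pi.
have b0 : 0 < b by rewrite divr_gt0 // mulr_gt0.
pose N : R := 4 ^+ n.
have N0 : 0 < N by rewrite exprn_gt0.
have rn0 := r_gt0 n.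
pose a := N * r n * b.
have a0 : 0 < a := mulr_gt0 (mulr_gt0 N0 rn0) b0.
pose c s := center_from r omega [::] (0, 0) s.
pose O s t := overlap_directions (r n) (c s) (c t).
have mO s t : measurable (O s t).
  rewrite (_ : O s t = `[0, pi]%classic `&` [set theta |
    `]-oo, 2 * r n]%classic `|linear_proj theta (c s) - linear_proj theta (c t)|]).
    apply: measurableI => //; apply: measurable_preimageT => //.
    apply: measurableT_comp => //.
    by apply: measurable_funB; exact: measurable_linear_proj.
  by apply/seteqP; split => x; rewrite /= !in_itv.
pose J theta s := [set x : R | `|x - linear_proj theta (c s)| <= r n].
have mJ theta s : measurable (J theta s).
  rewrite (_ : J theta s = `[linear_proj theta (c s) - r n,
    linear_proj theta (c s) + r n]%classic) //.
  by apply/seteqP; split => x; rewrite /J /= in_itv /= ler_distl.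
have lJ theta s : lebesgue_measure (J theta s) = (2 * r n)%:E.
  exact: lebesgue_measure_segment (ltW rn0).
have ai0 : 0 <= a^-1 by rewrite invr_ge0; exact: ltW.
have k0 : (0 <= (a^-1 * (2 * r n))%:E)%E.
  by rewrite lee_fin; apply: mulr_ge0 => //; rewrite mulr_ge0 // ltW.
have pointwise theta : theta \in `[0, pi] ->
    ((4 * N * r n)%:E <=
     a%:E * lebesgue_measure (proj_stage r omega theta [::] n) +
     (a^-1 * (2 * r n))%:E *
       \sum_(s <- words n) \sum_(t <- words n) (\1_(O s t) theta)%:E)%E.
  rewrite in_itv /= => thetaD.
  have JA s : s \in words n -> J theta s `<=` proj_stage r omega theta [::] n.
    rewrite mem_words => /eqP sn x xs.
    have p0 : linear_proj theta (0, 0) = 0 :> R by rewrite /linear_proj !mul0r addr0.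
    by rewrite -(subr0 x) -p0; apply/proj_stageP; exists s.
  have := second_moment_bound lebesgue_measure a0 (mJ theta)
    (measurable_proj_stage_fixed theta [::] n) JA.
  rewrite (eq_bigr (fun=> (2 * r n)%:E)); last by move=> s _; exact: lJ.
  rewrite sumEFin big_const_seq count_predT size_words iter_addr_0 -EFinM.
  rewrite -[2 * r n *+ _]mulr_natl natrX -/N.
  rewrite (_ : 2 * (N * (2 * r n)) = 4 * N * r n); last by ring.
  move/le_trans; apply; apply: leeD => //.
  rewrite EFinM -muleA lee_wpmul2l ?lee_fin ?invr_ge0 ?(ltW a0) //.
  rewrite ge0_sume_distrr; last by move=> s _; apply: sume_ge0.
  apply: lee_sum => s _; rewrite ge0_sume_distrr //; apply: lee_sum => t _.
  rewrite indicE; have [//|] := boolP (theta \in O s t).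
    move=> _; rewrite mule1 -(lJ theta s).
    by apply: le_outer_measure => x [].
  move=> nO; rewrite mule0 (_ : _ `&` _ = set0) ?measure0 //.
  rewrite -subset0 => x [xs xt]; move: nO; rewrite notin_setE; apply; split => //.
  rewrite [X in `|X|](_ : _ = (x - linear_proj theta (c t)) -
    (x - linear_proj theta (c s))); last by ring.
  by rewrite (le_trans (ler_normB _ _)) // mulr_natl mulr2n lerD.
have mind s t : measurable_fun setT (fun theta => (\1_(O s t) theta : R)%:E).
  by apply/measurable_EFinP.
have int_le : ((4 * N * r n * pi)%:E <= a%:E * Fav_stage n +
    (a^-1 * (2 * r n))%:E *
    \sum_(s <- words n) \sum_(t <- words n) lebesgue_measure (O s t))%E.
  have -> : (\sum_(s <- words n) \sum_(t <- words n) lebesgue_measure (O s t) =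
      \int[lebesgue_measure]_(theta in `[0%R, pi])
      \sum_(s <- words n) \sum_(t <- words n) (\1_(O s t) theta)%:E)%E.
    rewrite ge0_integral_sum //.
    - apply: eq_bigr => s _; rewrite ge0_integral_sum //.
        apply: eq_bigr => t _; rewrite integral_indic //; last exact: mO.
        congr (lebesgue_measure _); apply/esym/setIidl => x [xD _].
        by rewrite /= in_itv.
      by move=> t; apply: measurable_funTS; exact: mind.
    - by move=> s; apply: emeasurable_sum => t; apply: measurable_funTS; exact: mind.
    - by move=> s x _; apply: sume_ge0.
  pose G theta := lebesgue_measure (proj_stage r omega theta [::] n).
  pose H theta := (\sum_(s <- words n) \sum_(t <- words n) (\1_(O s t) theta : R)%:E)%E.
  have mG : measurable_fun `[0, pi] G.
    by apply: measurable_funTS; have := measurable_proj_stage_measure n.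
  have mH : measurable_fun `[0, pi] H.
    apply: emeasurable_sum => s; apply: emeasurable_sum => t.
    by apply: measurable_funTS; exact: mind.
  have H0 theta : (0 <= H theta)%E.
    by apply: sume_ge0 => s _; apply: sume_ge0.
  have a0' : (0 <= a%:E)%E by rewrite lee_fin; exact: ltW.
  rewrite -[X in (_ * X + _)%E]/(\int[lebesgue_measure]_(theta in `[0%R, pi]) G theta)%E.
  rewrite -[X in (_ + _ * X)%E]/(\int[lebesgue_measure]_(theta in `[0%R, pi]) H theta)%E.
  rewrite -ge0_integralZl // -[X in (_ + X)%E]ge0_integralZl //.
  rewrite -ge0_integralD //; last 4 first.
  - by move=> x _; exact: mule_ge0.
  - exact: measurable_funeM.
  - by move=> x _; exact: mule_ge0.
  - exact: measurable_funeM.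
  rewrite (_ : (4 * N * r n * pi)%:E =
    (\int[lebesgue_measure]_(theta in `[0%R, pi]) (cst (4 * N * r n)%:E) theta)%E).
    apply: ge0_le_integral => //.
    - by move=> x _; rewrite lee_fin !mulr_ge0 // ltW.
    - by apply: emeasurable_funD; exact: measurable_funeM.
  rewrite integral_cst // [X in (_ * X)%E](_ : _ = pi%:E) -?EFinM //.
  exact: lebesgue_measure_0pi.
have := sum_overlap_directions hr r_gt0 omega [::] (0, 0) n; rewrite /= add0n => hsum.
have {}hsum : (\sum_(s <- words n) \sum_(t <- words n) lebesgue_measure (O s t) <=
    (N ^+ 2 * (128 * r n * S))%:E)%E.
  apply: (le_trans hsum); rewrite lee_fin.
  have -> : 16 ^+ n = N ^+ 2 :> R by rewrite /N -exprM mulnC exprM; congr (_ ^+ _); ring.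
  apply: (@le_trans _ _ (N ^+ 2 * (128 * r n *
      \sum_(0 <= l < n.+1) (4 ^- l / r l)))); last first.
    by rewrite !ler_wpM2l ?sqr_ge0 ?mulr_ge0 // ltW.
  rewrite big_nat_recr //= -/N (mulrDr (128 * r n)) [leRHS]mulrDr [leRHS]addrC lerD2r.
  rewrite (_ : N ^+ 2 * (128 * r n * (N^-1 / r n)) = N * 128); last first.
    by field; rewrite !gt_eqF.
  rewrite ler_wpM2l ?(ltW N0) //; have := @pihalf_lt2 R; lra.
have {int_le hsum} : ((4 * N * r n * pi)%:E <= a%:E * Fav_stage n +
    (a^-1 * (2 * r n) * (N ^+ 2 * (128 * r n * S)))%:E)%E.
  apply: (le_trans int_le); apply: leeD => //; rewrite [leRHS]EFinM.
  exact: lee_wpmul2l.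
have -> : a^-1 * (2 * r n) * (N ^+ 2 * (128 * r n * S)) = 2 * N * r n * pi.
  have aux (x y z w : R) : 0 < x -> 0 < y -> 0 < z -> 0 < w ->
      (x * y * (128 * z / w))^-1 * (2 * y) * (x ^+ 2 * (128 * y * z)) = 2 * x * y * w.
    by move=> x0 y0 z0 w0; field; rewrite !gt_eqF.
  exact: aux.
have : (0 <= Fav_stage n)%E by exact: integral_ge0.
case: (Fav_stage n) => [f _|_ _|//]; last by rewrite leey.
rewrite -EFinM -EFinD !lee_fin => h.
have : 2 * N * r n * pi <= a * f by lra.
rewrite /a /b.
rewrite (_ : 2 * N * r n * pi = N * r n * (2 * pi)); last by ring.
rewrite -[leRHS]mulrA ler_pM2l ?mulr_gt0 // => h2.
rewrite ler_pdivrMr ?mulr_gt0 //.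
have : pi * (2 * pi) <= pi * (128 * S / pi * f) by rewrite ler_pM2l.
rewrite (_ : pi * (128 * S / pi * f) = 128 * S * f); last first.
  by rewrite mulrA mulrCA divff ?mulr1 ?gt_eqF.
by lra.
Qed.

End favard_stage.

(** * Passage to the limit *)

Section favard_limit.
Context {R : realType} (r : nat -> R) (hr : admissible r) (omega : word -> R).

Let strip (A : set (R * R)) : set (R * R) := [set z | 0 <= z.1 <= pi] `&` A.

Lemma product_measure_strip (A : set (R * R)) :
  ((@lebesgue_measure R \x @lebesgue_measure R) (strip A) =
  \int[lebesgue_measure]_(theta in `[0%R, pi]) lebesgue_measure (xsection A theta))%E.
Proof.
rewrite /product_measure1 [RHS]integral_mkcond; apply: eq_integral => theta _ /=.
rewrite patchE mem_setE in_itv /=; case: ifPn => thetaD.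
  congr (lebesgue_measure _); apply/seteqP; split => x /=;
    rewrite /xsection /= /strip !inE; first by case.
  by split.
rewrite (_ : xsection _ _ = set0) ?measure0 // -subset0 => x.
by rewrite /xsection /= /strip inE /= => -[]; rewrite (negbTE thetaD).
Qed.

Lemma xsection_bigcap_stage_lines theta :
  xsection (\bigcap_n stage_lines r omega n) theta =
  linear_proj theta @` cantor r omega.
Proof.
rewrite image_linear_proj_cantorE //; apply/seteqP; split => x.
  by rewrite /xsection /= inE.
by rewrite /xsection /= inE.
Qed.

Lemma Fav_stage_strip n : ((@lebesgue_measure R \x @lebesgue_measure R)
  (strip (stage_lines r omega n)) = Fav_stage r omega n)%E.
Proof.
rewrite product_measure_strip; apply: eq_integral => theta _.
by rewrite xsection_stage_lines.
Qed.

Lemma Fav_cantor_strip : ((@lebesgue_measure R \x @lebesgue_measure R)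
  (\bigcap_n strip (stage_lines r omega n)) = Fav (cantor r omega))%E.
Proof.
have -> : \bigcap_n strip (stage_lines r omega n) =
    strip (\bigcap_n stage_lines r omega n).
  apply/seteqP; split => z; last by move=> [zD zK] n _; split => //; exact: zK.
  by move=> h; split; [case: (h 0%N I) | move=> n _; case: (h n I)].
rewrite [LHS]product_measure_strip; apply: eq_integral => theta _.
by rewrite xsection_bigcap_stage_lines.
Qed.

Lemma measurable_strip n : measurable (strip (stage_lines r omega n)).
Proof.
apply: measurableI; last exact: measurable_stage_lines.
rewrite (_ : mkset _ = [set z : R * R | `[0, pi]%classic z.1]).
  exact: measurable_preimageT.
by apply/seteqP; split => z /=; rewrite in_itv.
Qed.

Lemma Fav_cantor_le_stage n : (Fav (cantor r omega) <= Fav_stage r omega n)%E.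
Proof.
rewrite -Fav_cantor_strip -Fav_stage_strip; apply: le_measure; rewrite ?inE.
- by apply: bigcapT_measurable => k; exact: measurable_strip.
- exact: measurable_strip.
- exact: bigcap_inf.
Qed.

Lemma Fav_stage0_lty : (Fav_stage r omega 0 < +oo)%E.
Proof.
apply: (@le_lt_trans _ _ (\int[lebesgue_measure]_(theta in `[0%R, pi])
   (cst (2 * r 0)%:E) theta)%E).
  apply: ge0_le_integral => //.
  - by apply: measurable_funTS; have := measurable_proj_stage_measure r omega 0.
  - move=> theta _ /=; rewrite -(lebesgue_measure_segment 0 (hr.1 0%N)).
    by apply: le_outer_measure => x /=; rewrite subr0.
rewrite integral_cst // [X in (_ * X)%E](_ : _ = pi%:E) -?EFinM ?ltry //.
exact: lebesgue_measure_0pi.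
Qed.

Lemma cvg_Fav_stage : Fav_stage r omega n @[n --> \oo] --> Fav (cantor r omega).
Proof.
rewrite -Fav_cantor_strip.
under eq_fun do rewrite -Fav_stage_strip.
apply: nonincreasing_cvg_mu.
- by move: Fav_stage0_lty; rewrite -Fav_stage_strip.
- exact: measurable_strip.
- by apply: bigcapT_measurable => k; exact: measurable_strip.
move=> m n mn; apply/subsetPset => z [zD zn]; split => //.
exact: (proj_stage_decr hr mn zn).
Qed.

Lemma Fav_cantor_gt0 :
  (\sum_(0 <= j <oo) ((4 ^- j)%:E * ((r j)%:E)^-1) < +oo)%E ->
  (0 < Fav (cantor r omega))%E.
Proof.
set S := (\sum_(0 <= j <oo) _)%E => Slt.
have t0 j : (0 <= (4 ^- j)%:E * ((r j)%:E)^-1)%E.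
  by rewrite mule_ge0 ?lee_fin ?inve_ge0 ?invr_ge0 ?exprn_ge0 ?lee_fin ?hr.1.
have S0 : (0 <= S)%E by apply: nneseries_ge0 => j _ _.
have SE : S = (fine S)%:E by rewrite fineK // ge0_fin_numE.
have partial n : (\sum_(0 <= j < n) ((4 ^- j)%:E * ((r j)%:E)^-1) <= S)%E.
  by apply: nneseries_lim_ge => j _ _.
have r_gt0 n : 0 < r n.
  rewrite lt_neqAle hr.1 andbT eq_sym; apply/eqP => rn0.
  have := partial n.+1; rewrite big_nat_recr //= rn0 inve0.
  rewrite gt0_muley ?lte_fin ?invr_gt0 ?exprn_gt0 //.
  rewrite addey; last by rewrite gt_eqF // (lt_le_trans ltNy0) // sume_ge0.
  by rewrite leye_eq => /eqP SE'; move: Slt; rewrite SE'.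
have hS n : \sum_(0 <= l < n) (4 ^- l / r l) <= fine S.
  rewrite -lee_fin -SE (le_trans _ (partial n)) // -sumEFin lee_sum // => j _.
  by rewrite inver gt_eqF // EFinM.
have S_gt0 : 0 < fine S.
  by apply: lt_le_trans (hS 1%N); rewrite big_nat1 expr0 invr1 mul1r invr_gt0.
apply: (@lt_le_trans _ _ ((pi ^+ 2 / (64 * fine S))%:E)).
  by rewrite lte_fin divr_gt0 ?exprn_gt0 ?mulr_gt0 ?pi_gt0.
by apply: (cvge_to_ge cvg_Fav_stage); apply: nearW => n; exact: Fav_stage_lower_bound.
Qed.

End favard_limit.

(** * Independent groups of random variables *)

Section cylinders.
Context {R : realType} {d : measure_display} {T : measurableType d}
  (P : probability T R) {I : eqType} (X : I -> {RV P >-> R}).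

(** Events that constrain finitely many of the variables with index in [J];
    they form a pi-system generating the sigma-algebra of these variables. *)
Definition cylinder (J : set I) : set (set T) :=
  [set B | exists (s : seq I) (A : I -> set R),
    [/\ uniq s, forall i, i \in s -> J i, forall i, measurable (A i) &
        B = \bigcap_(i in [set` s]) (X i @^-1` A i)]].

Definition cylinder_type (J : set I) : Type := g_sigma_algebraType (cylinder J).

HB.instance Definition _ (J : set I) := Measurable.on (cylinder_type J).

Lemma measurable_cylinder J : cylinder J `<=` measurable.
Proof.
move=> _ [s [A [_ _ mA ->]]]; apply: fin_bigcap_measurable.
  exact: finite_seq.
by move=> i _; apply: measurable_preimageT.
Qed.

Lemma cylinderT J : cylinder J setT.
Proof.
exists [::], (fun=> setT); split => //.
by rewrite set_nil bigcap_set0.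
Qed.

Lemma cylinderI J : setI_closed (cylinder J).
Proof.
move=> _ _ [s1 [A1 [u1 J1 mA1 ->]]] [s2 [A2 [u2 J2 mA2 ->]]].
exists (undup (s1 ++ s2)), (fun i => (if i \in s1 then A1 i else setT) `&`
  (if i \in s2 then A2 i else setT)); split.
- exact: undup_uniq.
- by move=> i; rewrite mem_undup mem_cat => /orP[/J1|/J2].
- by move=> i; apply: measurableI; case: ifP.
apply/seteqP; split => [x [h1 h2] i _ /=|x h].
  by split; case: ifP => // si; [exact: h1|exact: h2].
split => i /= si; have /= := h i; rewrite mem_undup mem_cat si ?orbT => /(_ isT) [].
  by [].
by [].
Qed.

Lemma sigma_cylinder_measurable J : <<s cylinder J >> `<=` @measurable _ T.
Proof.
apply: smallest_sub; first exact: sigma_algebra_measurable.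
exact: measurable_cylinder.
Qed.

Lemma measurable_cylinder_id J :
  measurable_fun setT (idfun : T -> cylinder_type J).
Proof.
by move=> _ B mB; rewrite setTI preimage_id; exact: sigma_cylinder_measurable mB.
Qed.

Lemma measurable_coordinate J i : J i ->
  measurable_fun setT (X i : cylinder_type J -> R).
Proof.
move=> Ji _ B mB; rewrite setTI; apply: sub_sigma_algebra.
exists [:: i], (fun=> B); split => //.
- by move=> j; rewrite inE => /eqP ->.
- by rewrite set_cons1 bigcap_set1.
Qed.

Context (indX : mutually_independent X).

Lemma cylinder_independent J1 J2 B1 B2 :
  J1 `&` J2 = set0 -> cylinder J1 B1 -> cylinder J2 B2 ->
  P (B1 `&` B2) = (P B1 * P B2)%E.
Proof.
move=> J12 [s1 [A1 [u1 sJ1 mA1 ->]]] [s2 [A2 [u2 sJ2 mA2 ->]]].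
have s12 i : i \in s1 -> i \in s2 -> False.
  by move=> /sJ1 i1 /sJ2 i2; suff : set0 i by []; rewrite -J12.
pose A i := if i \in s1 then A1 i else A2 i.
have mA i : measurable (A i) by rewrite /A; case: ifP.
have E1 : \bigcap_(i in [set` s1]) (X i @^-1` A1 i) =
    \bigcap_(i in [set` s1]) (X i @^-1` A i).
  by apply: eq_bigcapr => i /= si; rewrite /A si.
have E2 : \bigcap_(i in [set` s2]) (X i @^-1` A2 i) =
    \bigcap_(i in [set` s2]) (X i @^-1` A i).
  apply: eq_bigcapr => i /= si; rewrite /A; case: ifP => // si1.
  by case: (s12 i).
rewrite E1 E2 (indX u1 mA) (indX u2 mA) -big_cat -indX //.
  congr (P _); apply/seteqP; split => [x [h1 h2] i|x h].
    by rewrite /= mem_cat => /orP[/h1|/h2].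
  by split => i /= si; apply: h; rewrite /= mem_cat si ?orbT.
rewrite cat_uniq u1 u2 /= andbT; apply/hasPn => i i2.
by apply/negP => i1; exact: s12 i1 i2.
Qed.

(** Both sides are finite measures in [B] that agree on the pi-system [G]. *)
Lemma independent_extend (G : set (set T)) (B1 : set T) :
  setI_closed G -> G setT -> G `<=` measurable -> measurable B1 ->
  (forall B, G B -> P (B1 `&` B) = (P B1 * P B)%E) ->
  forall B, <<s G >> B -> P (B1 `&` B) = (P B1 * P B)%E.
Proof.
move=> GI GT mG mB1 h B sB.
have p0 : 0 <= fine (P B1) by apply: fine_ge0.
have PB1 : P B1 = (fine (P B1))%:E by rewrite fineK // fin_num_measure.
have mscaleE A : mscale (NngNum p0) P A = (P B1 * P A)%E by rewrite [in RHS]PB1.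
have mrestrE A : mrestr P mB1 A = P (B1 `&` A) by rewrite setIC.
rewrite -mrestrE -mscaleE.
apply: (@g_sigma_algebra_measure_unique _ R T G mG (fun=> setT) (fun=> GT)) => //.
- by rewrite bigcup_const.
- by move=> A GA; have := h A GA; rewrite -mrestrE -mscaleE.
- move=> _; rewrite -[X in (X < _)%E]/(P (setT `&` B1)).
  by rewrite setTI ltey_eq fin_num_measure.
Qed.

Lemma sigma_cylinder_independent J1 J2 B1 B2 : J1 `&` J2 = set0 ->
  <<s cylinder J1 >> B1 -> <<s cylinder J2 >> B2 ->
  P (B1 `&` B2) = (P B1 * P B2)%E.
Proof.
move=> J12 s1 s2.
apply: (independent_extend (@cylinderI J2) (cylinderT J2)
  (@measurable_cylinder J2)) s2 => [|B cB].
  exact: sigma_cylinder_measurable s1.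
rewrite setIC muleC.
apply: (independent_extend (@cylinderI J1) (cylinderT J1)
  (@measurable_cylinder J1)) s1 => [|B' cB'].
  exact: measurable_cylinder cB.
by rewrite setIC muleC; apply: cylinder_independent J12 _ _.
Qed.

(** Disjoint groups of independent variables may be integrated one after the
    other: the image of [P] on the diagonal of the two generated sigma-algebras is
    the product measure.  The carrier [T] is kept, with two sigma-algebras, so that
    functions of infinitely many variables need no encoding. *)
Lemma integral_independent J1 J2
    (f : cylinder_type J1 * cylinder_type J2 -> \bar R) :
  J1 `&` J2 = set0 -> measurable_fun setT f -> (forall z, 0 <= f z)%E ->
  (\int[P]_t f (t, t) = \int[P]_t1 \int[P]_t2 f (t1, t2))%E.
Proof.
move=> J12 mf f0.
pose id1 : {mfun T >-> cylinder_type J1} := mfun_Sub (mem_set (@measurable_cylinder_id J1)).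
pose id2 : {mfun T >-> cylinder_type J2} := mfun_Sub (mem_set (@measurable_cylinder_id J2)).
have mdiag : measurable_fun setT (fun t : T => (id1 t, id2 t)).
  by apply: measurable_fun_pair.
pose diag : {mfun T >-> (cylinder_type J1 * cylinder_type J2)%type} :=
  mfun_Sub (mem_set mdiag).
transitivity (\int[distribution P diag]_z f z)%E.
  by rewrite ge0_integral_distribution.
transitivity (\int[(distribution P id1) \x (distribution P id2)]_z f z)%E.
  apply: eq_measure_integral => A mA _; apply/esym.
  apply: product_measure_unique => // B1 B2 mB1 mB2.
  rewrite /distribution /pushforward /=.
  by rewrite -(sigma_cylinder_independent J12 mB1 mB2).
rewrite fubini_tonelli1 // ge0_integral_distribution; last 2 first.
- exact: measurable_fun_fubini_tonelli_F.
- by move=> y; apply: integral_ge0.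
apply: eq_integral => t1 _; rewrite /fubini_F /=.
rewrite ge0_integral_distribution //.
exact: measurableT_comp.
Qed.

End cylinders.

(** * Overlap of siblings in a fixed direction *)

Definition child_part {R : realType} (r : nat -> R) (omega : word -> R)
    (theta : R) (i : word) (m : nat) (j : 'I_4) : set R :=
  [set x | proj_stage r omega theta (rcons i j) m
     (x - child_shift (r (size i) - r (size i).+1) (omega i) theta j)].

Section child_parts.
Context {R : realType} (r : nat -> R) (hr : admissible r) (omega : word -> R)
  (theta : R).

Lemma measurable_child_part i m j : measurable (child_part r omega theta i m j).
Proof.
apply: measurable_preimageT; last exact: measurable_proj_stage_fixed.
exact: measurable_funB.
Qed.

Lemma measure_child_part i m j :
  lebesgue_measure (child_part r omega theta i m j) =
  lebesgue_measure (proj_stage r omega theta (rcons i j) m).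
Proof. exact: lebesgue_measure_shift. Qed.

Lemma measure_proj_stage_le i m :
  (lebesgue_measure (proj_stage r omega theta i m) <= (2 * r (size i))%:E)%E.
Proof.
rewrite -(lebesgue_measure_segment 0 (hr.1 _)); apply: le_outer_measure => x /= h.
by rewrite subr0; exact: proj_stage_bounded h.
Qed.

Lemma proj_stageS i m :
  proj_stage r omega theta i m.+1 =
  (child_part r omega theta i m ord0 `|` child_part r omega theta i m child1) `|`
  (child_part r omega theta i m (inord 2) `|` child_part r omega theta i m ord_max).
Proof.
apply/seteqP; split => [x [j xj]|x].
  have : j = ord0 \/ j = child1 \/ j = inord 2 \/ j = ord_max.
    case: j {xj} => [[|[|[|[|//]]]] hj].
    - by left; exact: val_inj.
    - by right; left; exact: val_inj.
    - by right; right; left; apply: val_inj; rewrite /= inordK.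
    - by right; right; right; exact: val_inj.
  by case=> [jE|[jE|[jE|jE]]]; move: xj; rewrite jE;
    [left; left|left; right|right; left|right; right].
by move=> [[|]|[|]] xU; [exists ord0|exists child1|exists (inord 2)|exists ord_max].
Qed.

(** Inclusion-exclusion, keeping only the overlap of the first two children. *)
Lemma measure_proj_stageS i m :
  (lebesgue_measure (proj_stage r omega theta i m.+1) +
     lebesgue_measure (child_part r omega theta i m ord0 `&`
                       child_part r omega theta i m child1) <=
   \sum_(j : 'I_4) lebesgue_measure (proj_stage r omega theta (rcons i j) m))%E.
Proof.
under eq_bigr do rewrite -measure_child_part.
rewrite proj_stageS; set U := child_part r omega theta i m.
have mU j : measurable (U j) by exact: measurable_child_part.
have Ufin j : (lebesgue_measure (U j) < +oo)%E.
  rewrite measure_child_part; apply: (le_lt_trans (measure_proj_stage_le _ _)).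
  exact: ltry.
have U01 : (lebesgue_measure (U ord0 `|` U child1) +
    lebesgue_measure (U ord0 `&` U child1) =
    lebesgue_measure (U ord0) + lebesgue_measure (U child1))%E.
  have := @measureUfinl _ _ R (@lebesgue_measure R) _ _ (mU ord0) (mU child1) (Ufin ord0).
  move=> -> ; rewrite subeK //.
  rewrite ge0_fin_numE //; apply: le_lt_trans (Ufin ord0).
  by apply: le_outer_measure => x [].
rewrite !big_ord_recr big_ord0 /= add0e.
rewrite (_ : widen_ord _ _ = ord0); last exact: val_inj.
rewrite (_ : widen_ord _ _ = child1); last exact: val_inj.
rewrite (_ : widen_ord _ _ = inord 2); last by apply: val_inj; rewrite /= inordK.
rewrite -U01 -addeA addeAC; apply: leeD => //.
apply: (le_trans (outer_measureU2 (@lebesgue_measure R) _ _)); apply: leeD => //.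
exact: (outer_measureU2 (@lebesgue_measure R)).
Qed.

End child_parts.

(** * Mean length of a random projection *)

Section random_step.
Context {R : realType} (r : nat -> R) (hr : admissible r).
Context {d : measure_display} {T : measurableType d} (P : probability T R).
Context {I : eqType} (ind : word -> I) (X : I -> {RV P >-> R}).
Context (theta : R).
Local Notation cyl := (cylinder_type X).

(** [ind i] is the index of the variable used as angle at the word [i]: the word
    itself in one model, its length in the other. *)
Definition rotation (t : T) : word -> R := fun s => X (ind s) t.

Definition shadow (i : word) (m : nat) (t : T) : \bar R :=
  lebesgue_measure (proj_stage r (rotation t) theta i m).

Lemma measurable_stage_cylinder (J : set I) i m :
  (forall s, (size s < m)%N -> J (ind (i ++ s))) ->
  measurable [set z : cyl J * R | proj_stage r (rotation z.1) theta i m z.2].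
Proof.
move=> hJ.
apply: (@measurable_proj_stage _ (cyl J) R r (fun s t => X (ind s) t) (fun=> theta)).
  by move=> s sm; apply: measurable_coordinate; exact: hJ.
exact: measurable_cst.
Qed.

Lemma measurable_shadow_cylinder (J : set I) i m :
  (forall s, (size s < m)%N -> J (ind (i ++ s))) ->
  measurable_fun setT (shadow i m : cyl J -> \bar R).
Proof.
move=> hJ; have := measurable_fun_xsection (@lebesgue_measure R)
  (measurable_stage_cylinder hJ).
by apply: eq_measurable_fun => t _ /=; rewrite xsection_setE.
Qed.

Lemma measurable_shadow i m : measurable_fun setT (shadow i m).
Proof.
have := measurable_fun_xsection (@lebesgue_measure R)
  (@measurable_proj_stage _ T R r (fun s t => X (ind s) t) (fun=> theta) i m _ _).
have -> : (@lebesgue_measure R) \o xsection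
    [set z | proj_stage r ((fun s t => X (ind s) t)^~ z.1) theta i m z.2] = shadow i m.
  by apply/funext => t /=; rewrite xsection_setE.
by apply.
Qed.

Lemma shadow_ge0 i m t : (0 <= shadow i m t)%E.
Proof. exact: measure_ge0. Qed.

Lemma shadow_le i m t : (shadow i m t <= (2 * r (size i))%:E)%E.
Proof. exact: measure_proj_stage_le. Qed.

Definition mean_shadow (i : word) (m : nat) : \bar R := (\int[P]_t shadow i m t)%E.

Lemma mean_shadow_ge0 i m : (0 <= mean_shadow i m)%E.
Proof. by apply: integral_ge0 => t _; exact: shadow_ge0. Qed.

Lemma mean_shadow_le i m : (mean_shadow i m <= (2 * r (size i))%:E)%E.
Proof.
apply: (@le_trans _ _ (\int[P]_t (cst (2 * r (size i))%:E t))%E).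
  apply: ge0_le_integral => //.
  - exact: measurable_shadow.
  - by move=> t _; exact: shadow_le.
by rewrite integral_cst // [X in (_ * X)%E](probability_setT P) mule1.
Qed.

Context (iid : iid_uniform_angles X).
Context (thetaD : 0 <= theta <= pi).
Context (ind_sep : forall i s, s != [::] -> ind (i ++ s) != ind i).

(** Conditionally on the angles strictly below [i], the angle of [i] is uniform,
    so [overlap_lower_bound] bounds the mean overlap of the first two children. *)
Lemma mean_shadow_step i m : 0 < r (size i) ->
  (mean_shadow i m.+1 + ((4 * pi * r (size i))^-1)%:E *
    \int[P]_t (shadow (rcons i ord0) m t * shadow (rcons i child1) m t) <=
   \sum_(j : 'I_4) mean_shadow (rcons i j) m)%E.
Proof.
move=> ri0; set rho := r (size i) - r (size i).+1.
have pi0 := @pi_gt0 R.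
have rho_ge : 2 * r (size i).+1 <= rho.
  by have := hr.2.2 (size i); rewrite /rho; lra.
have r1 := hr.1 (size i).+1.
have rho0 : 0 < rho by have := hr.2.2 (size i); rewrite /rho; lra.
pose J1 : set I := [set a | exists2 s, s != [::] & a = ind (i ++ s)].
pose J2 : set I := [set ind i].
have J12 : J1 `&` J2 = set0.
  rewrite -subset0 => a [[s s0 ->]] /= sE.
  by have := ind_sep i s0; rewrite sE eqxx.
have descJ1 j s : J1 (ind (rcons i j ++ s)).
  by exists (j :: s) => //; rewrite cat_rcons.
pose Q (z : cyl J1 * cyl J2) : set R :=
  [set x | proj_stage r (rotation z.1) theta (rcons i ord0) m
             (x - child_shift rho (X (ind i) z.2) theta ord0) /\
           proj_stage r (rotation z.1) theta (rcons i child1) m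
             (x - child_shift rho (X (ind i) z.2) theta child1)].
have mQ : measurable [set z : (cyl J1 * cyl J2) * R | Q z.1 z.2].
  have mj j : measurable [set z : (cyl J1 * cyl J2) * R |
      proj_stage r (rotation z.1.1) theta (rcons i j) m
             (z.2 - child_shift rho (X (ind i) z.1.2) theta j)].
    apply: (measurable_preimageT (f := fun z : (cyl J1 * cyl J2) * R =>
       (z.1.1, z.2 - child_shift rho (X (ind i) z.1.2) theta j))
       (B := [set z : cyl J1 * R | proj_stage r (rotation z.1) theta (rcons i j) m z.2])).
      apply: measurable_fun_pair; first exact: measurableT_comp.
      apply: measurable_funB => //; apply: measurable_child_shift => //.
      apply: (@measurableT_comp _ _ _ _ _ _ (X (ind i) : cyl J2 -> R)).
        exact: measurable_coordinate.
      exact: measurableT_comp.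
    by apply: measurable_stage_cylinder => s _; exact: descJ1.
  exact: measurableI (mj ord0) (mj child1).
pose f z := lebesgue_measure (Q z).
have mf : measurable_fun setT f.
  have := measurable_fun_xsection (@lebesgue_measure R) mQ.
  by apply: eq_measurable_fun => t _ /=; rewrite xsection_setE.
have overlapE : (\int[P]_t f (t, t) = \int[P]_t1 \int[P]_t2 f (t1, t2))%E.
  by apply: (integral_independent iid.1 J12 mf) => z; exact: measure_ge0.
have inner t1 : (((4 * pi * r (size i))^-1)%:E *
    (shadow (rcons i ord0) m t1 * shadow (rcons i child1) m t1) <=
    \int[P]_t2 f (t1, t2))%E.
  pose S j := proj_stage r (rotation t1) theta (rcons i j) m.
  have mS j : measurable (S j) by exact: measurable_proj_stage_fixed.
  pose g phi := lebesgue_measure [set x | S ord0 (x - child_shift rho phi theta ord0) /\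
             S child1 (x - child_shift rho phi theta child1)].
  have mg : measurable_fun setT g.
    have mA : measurable [set z : R * R | S ord0 (z.2 - child_shift rho z.1 theta ord0) /\
             S child1 (z.2 - child_shift rho z.1 theta child1)].
      have mj j : measurable [set z : R * R | S j (z.2 - child_shift rho z.1 theta j)].
        apply: measurable_preimageT => //; apply: measurable_funB => //.
        exact: measurable_child_shift.
      exact: measurableI (mj ord0) (mj child1).
    have := measurable_fun_xsection (@lebesgue_measure R) mA.
    by apply: eq_measurable_fun => t _ /=; rewrite xsection_setE.
  have -> : (\int[P]_t2 f (t1, t2) =
      (2 * pi)^-1%:E * \int[lebesgue_measure]_(phi in `[0%R, (2 * pi)%R]) g phi)%E.
    (* The uniform law is a measure on the sigma-algebra generated by the half-open
       intervals, so the variable is viewed with values in that measurable space. *)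
    have mX : @measurable_fun _ _ T (measurableTypeR R) setT (X (ind i)).
      by have := measurable_funPT (X (ind i)).
    pose Xi : {mfun T >-> measurableTypeR R} :=
      @mfun_Sub _ _ T (measurableTypeR R) _ (mem_set mX).
    transitivity (\int[distribution P Xi]_phi g phi)%E.
      by rewrite ge0_integral_distribution // => y; exact: measure_ge0.
    transitivity (\int[uniform_prob (@two_pi_gt0 R)]_phi g phi)%E.
      by apply: eq_measure_integral => A mA _; exact: (iid.2 (ind i) A mA).
    by rewrite integral_uniform // ?subr0 // => y; exact: measure_ge0.
  have Sle j x : S j x -> `|x| <= r (size i).+1.
    by move=> /(proj_stage_bounded hr); rewrite size_rcons.
  have := overlap_lower_bound rho0 rho_ge thetaD (mS ord0) (mS child1)
    (Sle ord0) (Sle child1).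
  rewrite -/(g _) => lb.
  have k0 : (0 <= ((4 * pi * r (size i))^-1)%:E)%E.
    by rewrite lee_fin invr_ge0 !mulr_ge0 ?hr.1 // ltW.
  apply: (le_trans (lee_wpmul2l k0 lb)); rewrite muleA -EFinM.
  apply: lee_wpmul2r; first by apply: integral_ge0 => y _; exact: measure_ge0.
  have aux (x y : R) : 0 < x -> 0 < y -> (2 * x)^-1 = (4 * x * y)^-1 * (2 * y).
    by move=> x0 y0; field; rewrite !gt_eqF.
  rewrite lee_fin (aux _ _ pi0 ri0).
  by rewrite ler_wpM2l ?invr_ge0 ?mulr_ge0 ?hr.1 ?(ltW pi0) // /rho; lra.
have m2 : measurable_fun setT
    (fun t => shadow (rcons i ord0) m t * shadow (rcons i child1) m t)%E.
  by apply: emeasurable_funM; exact: measurable_shadow.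
have overlap_ge : (((4 * pi * r (size i))^-1)%:E *
    \int[P]_t (shadow (rcons i ord0) m t * shadow (rcons i child1) m t) <=
    \int[P]_t f (t, t))%E.
  rewrite overlapE -ge0_integralZl //; last 2 first.
  - by move=> t _; rewrite mule_ge0 ?shadow_ge0.
  - by rewrite lee_fin invr_ge0 !mulr_ge0 ?hr.1 // ltW.
  apply: ge0_le_integral => //.
  - move=> t _; rewrite mule_ge0 ?mule_ge0 ?shadow_ge0 //.
    by rewrite lee_fin invr_ge0 !mulr_ge0 ?hr.1 // ltW.
  - exact: measurable_funeM.
  apply: (measurable_fun_fubini_tonelli_F (m2 := P) (fun z : T * T => f (z.1, z.2))).
    apply: (measurableT_comp mf); apply: measurable_fun_pair.
      by move=> _ B mB; apply: measurable_fst => //; exact: sigma_cylinder_measurable mB.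
    by move=> _ B mB; apply: measurable_snd => //; exact: sigma_cylinder_measurable mB.
  by move=> z; exact: measure_ge0.
have mfd : measurable_fun setT (fun t : T => f (t, t)).
  apply: (measurableT_comp mf); apply: measurable_fun_pair.
    exact: measurable_cylinder_id.
  exact: measurable_cylinder_id.
have fd0 (t : T) : (0 <= f (t, t))%E by exact: measure_ge0.
apply: (@le_trans _ _ (\int[P]_t (shadow i m.+1 t + f (t, t)))%E).
  rewrite ge0_integralD //; last exact: measurable_shadow.
  by apply: leeD.
rewrite /mean_shadow -ge0_integral_sum //; last by move=> j; exact: measurable_shadow.
apply: ge0_le_integral => //.
- by move=> t _; rewrite adde_ge0 ?shadow_ge0.
- by apply: emeasurable_funD => //; exact: measurable_shadow.
- by apply: emeasurable_sum => j; exact: measurable_shadow.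
by move=> t _; exact: measure_proj_stageS.
Qed.

End random_step.

(** * The recursion for the mean lengths *)

(** With equal values on each level, the rescaled lengths [a = 4 ^ k * e] satisfy
    [a' <= a - c * s * a ^ 2] with [s = 4 ^- k / r k] and [c = 1 / (64 * pi)];
    hence [1 / a' >= 1 / a + c * s], and these increments add up.  When the values
    differ, they may be replaced by the largest one [M], because the
    bound is increasing in each of them as long as they do not exceed [r k]. *)
Lemma length_recursion {R : realType} (r : nat -> R) (e : word -> nat -> R) :
  admissible r -> (forall n, 0 < r n) ->
  (forall i m, 0 <= e i m) -> (forall i m, e i m <= 2 * r (size i)) ->
  (forall i m, e i m.+1 + (4 * pi * r (size i))^-1 *
      (e (rcons i ord0) m * e (rcons i child1) m) <=
    \sum_(j : 'I_4) e (rcons i j) m) ->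
  forall m i, 4 ^+ size i * e i m *
    (\sum_(0 <= l < m) (4 ^- (size i + l) / r (size i + l)%N)) <= 64 * pi.
Proof.
move=> hr r_gt0 e0 er step.
have pi2 := @pi_ge2 R.
have pi0 := @pi_gt0 R.
elim=> [|m IH] i; first by rewrite big_geq // mulr0 mulr_ge0 // ltW.
have := step i m; set k := size i; set p := r k; set q := (4 * pi * p)^-1 => st.
have p0 : 0 < p by exact: r_gt0.
have q0 : 0 < q by rewrite invr_gt0 !mulr_gt0.
pose sg := \sum_(0 <= l < m) (4 ^- (k.+1 + l) / r (k.+1 + l)%N).
have -> : \sum_(0 <= l < m.+1) (4 ^- (k + l) / r (k + l)%N) = 4 ^- k / p + sg.
  rewrite big_nat_recl // addn0; congr (_ + _).
  by apply: eq_bigr => l _; rewrite addSnnS.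
have sg0 : 0 <= sg.
  by apply: sumr_ge0 => l _; rewrite divr_ge0 ?invr_ge0 ?exprn_ge0 // ltW.
case: (@arg_maxP _ _ _ (ord0 : 'I_4) predT (fun j => e (rcons i j) m)) => // j _ jmax.
set M := e (rcons i j) m in jmax.
have {}jmax a : e (rcons i a) m <= M by exact: jmax.
have M0 : 0 <= M by exact: e0.
have Mp : M <= p.
  have := er (rcons i j) m; rewrite size_rcons -/M -/k => Mr.
  by have := hr.2.2 k; rewrite -/p; lra.
have MIH : 4 ^+ k * 4 * M * sg <= 64 * pi.
  by have := IH (rcons i j); rewrite size_rcons -/k -/M -/sg exprS; lra.
have qp : q * p * pi = 4^-1.
  have aux (x y : R) : 0 < x -> 0 < y -> (4 * x * y)^-1 * y * x = 4^-1.
    by move=> x0 y0; field; rewrite !gt_eqF.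
  exact: aux.
have qp1 : q * p <= 4^-1 by nra.
have sumM : \sum_(j : 'I_4) e (rcons i j) m <=
    e (rcons i ord0) m + e (rcons i child1) m + 2 * M.
  rewrite !big_ord_recr big_ord0 /= add0r.
  rewrite (_ : widen_ord _ _ = ord0); last exact: val_inj.
  rewrite (_ : widen_ord _ _ = child1); last exact: val_inj.
  rewrite (_ : widen_ord _ _ = inord 2); last by apply: val_inj; rewrite /= inordK.
  by have := jmax (inord 2); have := jmax ord_max; lra.
have eM : e i m.+1 <= 4 * M - q * M ^+ 2.
  move: (jmax ord0) (jmax child1) (e0 (rcons i ord0) m) (e0 (rcons i child1) m).
  move: st sumM; rewrite /=.
  set x := e (rcons i ord0) m; set y := e (rcons i child1) m => st sumM xM yM x0 y0.
  have h1 : 0 <= (M - x) * (1 - q * y).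
    rewrite mulr_ge0 ?subr_ge0 //; apply: (le_trans _ (_ : 4^-1 <= 1)); last by lra.
    by apply: le_trans qp1; rewrite ler_pM2l // (le_trans yM).
  have h2 : 0 <= (M - y) * (1 - q * M).
    rewrite mulr_ge0 ?subr_ge0 //; apply: (le_trans _ (_ : 4^-1 <= 1)); last by lra.
    by apply: le_trans qp1; rewrite ler_pM2l.
  nra.
set N := 4 ^+ k : R in MIH *.
have N0 : 0 < N by rewrite exprn_gt0.
set C := 64 * pi : R; set s := N^-1 / p.
have C0 : 0 < C by rewrite mulr_gt0.
have s0 : 0 <= s by rewrite divr_ge0 ?invr_ge0 ?ltW.
(* In terms of [u = a * s / C], which lies between [0] and [1], the bound to prove is
   [(1 - u) * (1 + u) <= 1]. *)
pose a := 4 * N * M.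
have a0 : 0 <= a := mulr_ge0 (mulr_ge0 (ler0n _ _) (ltW N0)) M0.
have aE : N * (4 * M - q * M ^+ 2) = a - a ^+ 2 * s / C.
  have aux (x y z t : R) : 0 < x -> 0 < y -> 0 < z ->
      z * (4 * t - (4 * x * y)^-1 * t ^+ 2) =
      4 * z * t - (4 * z * t) ^+ 2 * (z^-1 / y) / (64 * x).
    by move=> x0 y0 z0; field; rewrite !gt_eqF.
  exact: aux.
have asE : a * s <= C.
  have -> : a * s = 4 * (M / p) by rewrite /a /s; field; rewrite !gt_eqF.
  have : M / p <= 1 by rewrite ler_pdivrMr // mul1r.
  by rewrite /C; lra.
have asg : a * sg <= C by rewrite /a /C; lra.
apply: (@le_trans _ _ ((a - a ^+ 2 * s / C) * (s + sg))).
  by rewrite -aE ler_wpM2r ?addr_ge0 // ler_pM2l.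
pose u := a * s / C.
have u0 : 0 <= u := divr_ge0 (mulr_ge0 a0 s0) (ltW C0).
have u1 : u <= 1 by rewrite ler_pdivrMr // mul1r.
have -> : (a - a ^+ 2 * s / C) * (s + sg) = (1 - u) * (a * s + a * sg).
  by rewrite /u; ring.
have -> : a * s = C * u by rewrite /u [RHS]mulrC divfK // gt_eqF.
apply: (@le_trans _ _ ((1 - u) * (C * u + C))).
  by rewrite ler_wpM2l ?subr_ge0 // lerD2l.
rewrite [leLHS](_ : _ = C - C * u ^+ 2); last by ring.
by rewrite lerBlDr lerDl mulr_ge0 ?sqr_ge0 // ltW.
Qed.

(** * Correlation of siblings in the two models *)

Lemma proj_stage_size {R : realType} (r : nat -> R) (omega : nat -> R)
    (theta : R) (i k : word) (m : nat) : size i = size k ->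
  proj_stage r (fun s => omega (size s)) theta i m =
  proj_stage r (fun s => omega (size s)) theta k m.
Proof.
elim: m i k => [|m IH] i k ik /=; first by rewrite ik.
apply/seteqP; split => x [j xj]; exists j; move: xj; rewrite ik;
  by rewrite (IH (rcons i j) (rcons k j)) // !size_rcons ik.
Qed.

(** Two siblings project to independent sets. *)
Lemma independent_shadow_correlation {R : realType} (r : nat -> R)
    {d : measure_display} {T : measurableType d} (P : probability T R)
    (X : word -> {RV P >-> R}) (theta : R) (i : word) (m : nat) :
  mutually_independent X ->
  (mean_shadow r id X theta (rcons i ord0) m *
   mean_shadow r id X theta (rcons i child1) m <=
   \int[P]_t (shadow r id X theta (rcons i ord0) m t *
              shadow r id X theta (rcons i child1) m t))%E.
Proof.
move=> indX.
pose J (j : 'I_4) : set word := [set rcons i j ++ s | s in setT].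
have J01 : J ord0 `&` J child1 = set0.
  rewrite -subset0 => a [[s _ <-] [t _]]; rewrite !cat_rcons => /eqP.
  by rewrite eqseq_cat // eqxx /= eqseq_cons.
pose f (z : cylinder_type X (J ord0) * cylinder_type X (J child1)) :=
  (shadow r id X theta (rcons i ord0) m z.1 * shadow r id X theta (rcons i child1) m z.2)%E.
have mj j : measurable_fun setT
    (shadow r id X theta (rcons i j) m : cylinder_type X (J j) -> \bar R).
  by apply: measurable_shadow_cylinder => s _; exists s.
have mf : measurable_fun setT f.
  by apply: emeasurable_funM; 
    [exact: (measurableT_comp (mj ord0)) | exact: (measurableT_comp (mj child1))].
have f0 z : (0 <= f z)%E by apply: mule_ge0; exact: shadow_ge0.
have := integral_independent indX J01 mf f0; rewrite /f /= => ->.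
rewrite (eq_integral (fun t => shadow r id X theta (rcons i ord0) m t *
    mean_shadow r id X theta (rcons i child1) m)%E); last first.
  move=> t _; rewrite ge0_integralZl ?shadow_ge0 //.
  exact: measurable_shadow.
rewrite ge0_integralZr //.
- exact: measurable_shadow.
- exact: mean_shadow_ge0.
Qed.

(** Two siblings project to translates of the same random set; the variance of
    its length is nonnegative. *)
Lemma synchronized_shadow_correlation {R : realType} (r : nat -> R)
    {d : measure_display} {T : measurableType d} (P : probability T R)
    (X : nat -> {RV P >-> R}) (theta : R) (i : word) (m : nat) :
  admissible r ->
  (mean_shadow r size X theta (rcons i ord0) m *
   mean_shadow r size X theta (rcons i child1) m <=
   \int[P]_t (shadow r size X theta (rcons i ord0) m t *
              shadow r size X theta (rcons i child1) m t))%E.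
Proof.
move=> hr.
set sh := shadow r size X theta (rcons i ord0) m.
have shE : shadow r size X theta (rcons i child1) m = sh.
  apply/funext => t; rewrite /sh /shadow.
  rewrite (proj_stage_size _ (fun n => X n t) _ _ (i := rcons i child1)
    (k := rcons i ord0)) //.
  by rewrite !size_rcons.
rewrite /mean_shadow shE -/sh.
have sh0 t : (0 <= sh t)%E by exact: shadow_ge0.
have msh : measurable_fun setT sh by exact: measurable_shadow.
have shfin t : sh t = (fine (sh t))%:E.
  rewrite fineK // ge0_fin_numE //; apply: le_lt_trans (ltry _).
  exact: shadow_le.
have mean0 : (0 <= \int[P]_t sh t)%E by exact: integral_ge0.
have [c c0 cE] : exists2 c : R, 0 <= c & (\int[P]_t sh t = c%:E)%E.
  exists (fine (\int[P]_t sh t)%E); first exact: fine_ge0.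
  rewrite fineK // ge0_fin_numE //.
  by apply: le_lt_trans (mean_shadow_le hr size X theta (rcons i ord0) m) (ltry _).
have m2 : measurable_fun setT (fun t => sh t * sh t)%E by exact: emeasurable_funM.
have : (\int[P]_t ((2 * c)%:E * sh t) <= \int[P]_t (sh t * sh t + (c * c)%:E))%E.
  apply: ge0_le_integral => //.
  - by move=> t _; rewrite mule_ge0 // lee_fin mulr_ge0.
  - exact: measurable_funeM.
  - exact: emeasurable_funD.
  move=> t _; rewrite (shfin t) -!EFinM -EFinD lee_fin -subr_ge0.
  rewrite (_ : _ - _ = (fine (sh t) - c) ^+ 2) ?sqr_ge0 //; ring.
rewrite ge0_integralZl //; last by rewrite lee_fin mulr_ge0.
rewrite ge0_integralD //; last first.
  - by move=> t _; rewrite lee_fin mulr_ge0.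
  - by move=> t _; rewrite mule_ge0.
rewrite (_ : (\int[P]_x (c * c)%:E)%E = (c * c)%:E); last first.
  by rewrite -[LHS]/(\int[P]_x (cst (c * c)%:E x))%E integral_cst //
    [X in (_ * X)%E](probability_setT P) mule1.
rewrite cE -EFinM -leeBlDr // -EFinB -EFinM.
by rewrite (_ : 2 * c * c - c * c = c * c) //; ring.
Qed.

(** * Almost sure vanishing of the Favard length *)

Lemma measure_proj_stage_le_discs {R : realType} (r : nat -> R)
    (hr : admissible r) (omega : word -> R) (theta : R) (i : word) (m : nat) :
  (lebesgue_measure (proj_stage r omega theta i m) <=
   (4 ^+ m * (2 * r (size i + m)%N))%:E)%E.
Proof.
elim: m i => [|m IH] i; first by rewrite expr0 mul1r addn0; exact: measure_proj_stage_le.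
apply: le_trans (le_trans (measure_proj_stageS hr omega theta i m) _).
  by rewrite leeDl.
apply: (@le_trans _ _ (\sum_(j : 'I_4) (4 ^+ m * (2 * r (size i + m.+1)%N))%:E)%E).
  by apply: lee_sum => j _; have := IH (rcons i j); rewrite size_rcons addSnnS.
by rewrite sumEFin lee_fin sumr_const card_ord exprS -[leRHS]mulrA [leRHS]mulr_natl.
Qed.

Section almost_sure.
Context {R : realType} (r : nat -> R) (hr : admissible r).
Context {d : measure_display} {T : measurableType d} (P : probability T R).
Context {I : eqType} (ind : word -> I) (X : I -> {RV P >-> R}).
Context (iid : iid_uniform_angles X).
Context (ind_sep : forall i s, s != [::] -> ind (i ++ s) != ind i).
Context (correlation : forall theta i m,
  (mean_shadow r ind X theta (rcons i ord0) m *
   mean_shadow r ind X theta (rcons i child1) m <=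
   \int[P]_t (shadow r ind X theta (rcons i ord0) m t *
              shadow r ind X theta (rcons i child1) m t))%E).

Let D : set R := `[0, pi]%classic.
(** The length in direction [z.2], cut off outside [0, pi] so that Fubini's
    theorem applies on the whole product space. *)
Let h n (z : T * R) : \bar R :=
  if z.2 \in D then shadow r ind X z.2 [::] n z.1 else 0%E.

Lemma Fav_stage_rotation n t :
  Fav_stage r (rotation ind X t) n = (\int[lebesgue_measure]_theta h n (t, theta))%E.
Proof.
rewrite /Fav_stage integral_mkcond; apply: eq_integral => theta _.
by rewrite patchE.
Qed.

Lemma measurable_Fav_stage_kernel n : measurable_fun setT (h n).
Proof.
pose w (s : word) (z : T * R) := X (ind s) z.1.
have mw : measurable [set z : (T * R) * R |
    proj_stage r (fun s => w s z.1) z.1.2 [::] n z.2].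
  apply: (@measurable_proj_stage _ (T * R)%type R r w snd) => //.
  by move=> s _; apply: measurableT_comp.
have mA : measurable [set z : (T * R) * R | D z.1.2 /\
    proj_stage r (fun s => w s z.1) z.1.2 [::] n z.2].
  have mD : measurable [set z : (T * R) * R | D z.1.2].
    apply: (measurable_preimageT (f := fun z : (T * R) * R => z.1.2)).
      exact: measurableT_comp.
    exact: measurable_itv.
  exact: measurableI mD mw.
have := measurable_fun_xsection (@lebesgue_measure R) mA.
apply: eq_measurable_fun => z _ /=; rewrite xsection_setE /h.
case: ifPn => zD.
  congr (lebesgue_measure _); apply/seteqP; split => x /=; first by case.
  by split => //; move: zD; rewrite inE.
rewrite (_ : mkset _ = set0) ?measure0 // -subset0 => x [zD' _].
by move: zD; rewrite notin_setE; apply.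
Qed.

Lemma Fav_stage_kernel_ge0 n z : (0 <= h n z)%E.
Proof. by rewrite /h; case: ifP => // _; exact: shadow_ge0. Qed.

Lemma measurable_Fav_stage n :
  measurable_fun setT (fun t => Fav_stage r (rotation ind X t) n).
Proof.
under eq_fun do rewrite Fav_stage_rotation.
apply: (measurable_fun_fubini_tonelli_F (m2 := @lebesgue_measure R) (h n)).
  exact: measurable_Fav_stage_kernel.
exact: Fav_stage_kernel_ge0.
Qed.

Lemma measurable_Fav_cantor :
  measurable_fun setT (fun t => Fav (cantor r (rotation ind X t))).
Proof.
apply: (emeasurable_fun_cvg (fun n t => Fav_stage r (rotation ind X t) n)).
  exact: measurable_Fav_stage.
by move=> t _; exact: cvg_Fav_stage.
Qed.

Lemma mean_Fav_stage_le (s : R) n : (forall n, 0 < r n) -> 0 < s ->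
  s <= \sum_(0 <= l < n) (4 ^- l / r l) ->
  (\int[P]_t Fav_stage r (rotation ind X t) n <= (64 * pi ^+ 2 / s)%:E)%E.
Proof.
move=> r_gt0 s0 hs.
have pi0 := @pi_gt0 R.
under eq_integral do rewrite Fav_stage_rotation.
have := fubini_tonelli (m1 := P) (m2 := @lebesgue_measure R) (h n)
  (measurable_Fav_stage_kernel n) (Fav_stage_kernel_ge0 n).
move=> ->.
have mean_le theta : 0 <= theta <= pi ->
    (mean_shadow r ind X theta [::] n <= (64 * pi / s)%:E)%E.
  move=> thetaD.
  have fin i m : mean_shadow r ind X theta i m =
      (fine (mean_shadow r ind X theta i m))%:E.
    rewrite fineK // ge0_fin_numE ?mean_shadow_ge0 //.
    exact: le_lt_trans (mean_shadow_le hr _ _ _ _ _) (ltry _).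
  have := @length_recursion R r (fun i m => fine (mean_shadow r ind X theta i m))
    hr r_gt0 _ _ _ n [::].
  rewrite /= expr0 mul1r => rec.
  rewrite fin lee_fin ler_pdivlMr //.
  apply: (le_trans _ (rec _ _ _)).
  - by apply: ler_wpM2l => //; apply: fine_ge0; exact: mean_shadow_ge0.
  - by move=> i m; apply: fine_ge0; exact: mean_shadow_ge0.
  - by move=> i m; rewrite -lee_fin -fin; exact: mean_shadow_le.
  move=> i m; rewrite -lee_fin EFinD -sumEFin -fin !EFinM -!fin.
  under eq_bigr do rewrite -fin.
  apply: le_trans (mean_shadow_step hr iid thetaD ind_sep m (r_gt0 (size i))).
  apply: leeD => //; apply: lee_wpmul2l => //.
  by rewrite lee_fin invr_ge0 !mulr_ge0 ?hr.1 // ltW.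
apply: (@le_trans _ _ (\int[lebesgue_measure]_(theta in D)
    (cst (64 * pi / s)%:E theta))%E).
  rewrite [leRHS]integral_mkcond; apply: ge0_le_integral => //.
  - by move=> y _; apply: integral_ge0 => t _; exact: Fav_stage_kernel_ge0.
  - apply: (measurable_fun_fubini_tonelli_G (m1 := P) (h n)).
      exact: measurable_Fav_stage_kernel.
    exact: Fav_stage_kernel_ge0.
  - by apply/(measurable_restrictT _ _).1 => //; exact: measurable_itv.
  move=> theta _; rewrite patchE /h /=; case: ifPn => // thetaD.
    by apply: mean_le; move: thetaD; rewrite inE /D /= in_itv.
  by rewrite integral0.
rewrite integral_cst; last exact: measurable_itv.
rewrite [X in (_ * X)%E](_ : _ = pi%:E); last exact: lebesgue_measure_0pi.
by rewrite -EFinM lee_fin (_ : 64 * pi / s * pi = 64 * pi ^+ 2 / s) //; ring.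
Qed.

Lemma Fav_cantor_degenerate k : r k = 0 ->
  forall omega : word -> R, Fav (cantor r omega) = 0%E.
Proof.
move=> rk0 omega; apply/eqP; rewrite eq_le; apply/andP; split; last first.
  by apply: integral_ge0 => theta _; exact: measure_ge0.
apply: (le_trans (Fav_cantor_le_stage hr omega k)).
rewrite /Fav_stage integral0_eq // => theta _; apply/eqP.
rewrite -measure_le0; apply: (le_trans (measure_proj_stage_le_discs hr _ _ _ _)).
by rewrite add0n rk0 !mulr0.
Qed.

(** The mean of the Favard length is bounded by [64 * pi ^ 2] divided by any
    partial sum of the series, hence it vanishes. *)
Lemma Fav_cantor_ae0 :
  (\sum_(0 <= j <oo) ((4 ^- j)%:E * ((r j)%:E)^-1) = +oo)%E ->
  {ae P, forall t : T, Fav (cantor r (rotation ind X t)) = 0%E}.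
Proof.
move=> Sy.
have [[k rk0]|nr0] := pselect (exists k, r k = 0).
  by apply: aeW => t; exact: Fav_cantor_degenerate rk0 _.
have r_gt0 n : 0 < r n.
  rewrite lt_neqAle hr.1 andbT eq_sym; apply/eqP => rn0.
  by apply: nr0; exists n.
pose G t := Fav (cantor r (rotation ind X t)).
have G0 t : (0 <= G t)%E by apply: integral_ge0 => theta _; exact: measure_ge0.
have unbounded (s : R) : exists n, s <= \sum_(0 <= l < n) (4 ^- l / r l).
  apply: contrapT => bdd.
  have : (\sum_(0 <= j <oo) ((4 ^- j)%:E * ((r j)%:E)^-1) <= s%:E)%E.
    apply: lime_le.
      apply: is_cvg_nneseries => j _ _.
      by rewrite mule_ge0 ?inve_ge0 ?lee_fin ?invr_ge0 ?exprn_ge0 ?hr.1.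
    apply: nearW => n.
    rewrite (eq_bigr (fun j => (4 ^- j / r j)%:E)); last first.
      by move=> j _; rewrite inver gt_eqF // EFinM.
    rewrite sumEFin lee_fin leNgt; apply/negP => /ltW h'; apply: bdd.
    by exists n.
  by rewrite Sy.
have intG0 : (\int[P]_t G t = 0)%E.
  apply/eqP; rewrite eq_le integral_ge0 // andbT.
  apply/lee_addgt0Pr => e e0; rewrite add0e.
  have s0 : 0 < 64 * pi ^+ 2 / e by rewrite divr_gt0 // mulr_gt0 // exprn_gt0 // pi_gt0.
  have [n hn] := unbounded (64 * pi ^+ 2 / e).
  apply: (@le_trans _ _ (\int[P]_t Fav_stage r (rotation ind X t) n)%E).
    apply: ge0_le_integral => //.
    - exact: measurable_Fav_cantor.
    - exact: measurable_Fav_stage.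
    - by move=> t _; exact: Fav_cantor_le_stage.
  apply: (le_trans (mean_Fav_stage_le r_gt0 s0 hn)).
  rewrite lee_fin le_eqVlt; apply/orP; left; apply/eqP.
  have aux (x y : R) : 0 < x -> 0 < y -> x / (x / y) = y.
    by move=> x0 y0; field; rewrite !gt_eqF.
  by apply: aux => //; rewrite mulr_gt0 // exprn_gt0 // pi_gt0.
have /ae_eq_integral_abs := measurable_Fav_cantor.
move=> /(_ P measurableT) [+ _].
under eq_integral => t _ do rewrite (gee0_abs (G0 t)).
move=> /(_ intG0); by apply: filterS => t; apply.
Qed.

End almost_sure.

(** * Favard length of the Cantor set *)

Theorem corollary1p6 (R : realType) (r : nat -> R) (hr : admissible r) :
  ((\sum_(0 <= j <oo) ((4 ^- j)%:E * ((r j)%:E)^-1) < +oo)%E ->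
    forall omega : word -> R, (forall i : word, 0 <= omega i <= 2 * pi) ->
      (0 < Fav (cantor r omega))%E)
  /\
  ((\sum_(0 <= j <oo) ((4 ^- j)%:E * ((r j)%:E)^-1) = +oo)%E ->
    forall (d : measure_display) (T : measurableType d) (P : probability T R),
      (* independent rotations *)
      (forall omega : word -> {RV P >-> R}, iid_uniform_angles omega ->
        {ae P, forall x : T,
          Fav (cantor r (fun i : word => omega i x)) = 0%E})
      /\
      (* synchronized rotations *)
      (forall omega : nat -> {RV P >-> R}, iid_uniform_angles omega ->
        {ae P, forall x : T,
          Fav (cantor r (fun i : word => omega (size i) x)) = 0%E})).
Proof.
split=> [Slty omega _|Sy d T P]; first exact: Fav_cantor_gt0.
split=> omega iid.
- apply: (Fav_cantor_ae0 hr (ind := id) iid _ _ Sy).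
  + move=> i s s0; apply/eqP => /(congr1 size); rewrite size_cat => /eqP.
    by rewrite -[X in _ == X]addn0 eqn_add2l size_eq0 (negbTE s0).
  + by move=> theta i m; apply: independent_shadow_correlation; exact: iid.1.
- apply: (Fav_cantor_ae0 hr (ind := size) iid _ _ Sy).
  + move=> i s s0; rewrite size_cat.
    by rewrite -[X in _ != X]addn0 eqn_add2l size_eq0.
  + by move=> theta i m; apply: synchronized_shadow_correlation.
Qed.
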